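(* Let $\mathbb{F}=\mathbb{R}$, $\mathbb{C}$ or $\mathbb{H}$. Let $p_1,\ldots,p_k$ be such that each $p_i\in\mathbb{F}^{\nu_i\times\ell}\langle x,x^*\rangle$ for some $\nu_i\in\mathbb{N}$. For $\nu\in\mathbb{N}$ define $$J_\nu:=\mathbb{F}^{\nu\times1}\,\sqrt[\mathrm{rr}]{\sum_{i=1}^k\mathbb{F}^{1\times\nu_i}\langle x,x^*\rangle\,p_i}.$$ Let $q\in\mathbb{F}^{\nu\times\ell}\langle x,x^*\rangle$. Then $q(X)v=0$ for all $(X,v)\in\bigcup_{n\in\mathbb{N}}(\mathbb{F}^{n\times n})^g\times\mathbb{F}^{\ell n}$ such that $p_1(X)v=0,\ldots,p_k(X)v=0$ if and only if $q\in J_\nu$.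
   Context: $\mathbb{H}$ denotes the quaternions. $\mathbb{F}\langle x,x^*\rangle$ denotes the ring of non-commutative polynomials in the free letters $x_1,\ldots,x_g,x_1^*,\ldots,x_g^*$ with coefficients in $\mathbb{F}$. For $\mathbb{F}=\mathbb{R},\mathbb{C}$ the coefficients commute with the letters (free $\mathbb{F}$-algebra). For $\mathbb{F}=\mathbb{H}$ the letters do not commute with the non-real elements of $\mathbb{H}$ (only real scalars commute with the letters), i.e. $\mathbb{H}\langle x,x^*\rangle$ is the $\mathbb{R}$-algebra free product of $\mathbb{H}$ with $\mathbb{R}\langle x,x^*\rangle$. The involution $*$ is the $\mathbb{R}$-linear anti-automorphism exchanging $x_i$ and $x_i^*$ and acting on $\mathbb{F}$ by conjugation. $\mathbb{F}^{\nu\times\ell}\langle x,x^*\rangle$ is the set of $\nu\times\ell$ matrices over $\mathbb{F}\langle x,x^*\rangle$, with involution given by transposing and applying $*$ entrywise. Evaluation at $X\in(\mathbb{F}^{n\times n})^g$: replace $x_i$ by $X_i$, $x_i^*$ by the conjugate transpose $X_i^*$, and a scalar $a\in\mathbb{F}$ by $a\,\mathrm{Id}_n$; a matrix of polynomials $p\in\mathbb{F}^{\nu\times\ell}\langle x,x^*\rangle$ is evaluated entrywise, giving a block matrix $p(X)\in\mathbb{F}^{\nu n\times\ell n}$. For sets $A,B$ of matrices of compatible sizes, $AB$ is the additive span of products $ab$, $A^*=\{a^*\mid a\in A\}$, and $Bp:=B\{p\}$. A left module is a left $\mathbb{F}\langle x,x^*\rangle$-submodule $I$ of $\mathbb{F}^{1\times\ell}\langle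 x,x^*\rangle$; $\mathbb{F}^{\nu\times1}I$ is the set of $\nu\times\ell$ matrices whose rows lie in $I$. $I$ is real if whenever a finite sum $\sum_ip_i^*p_i$ with $p_i\in\mathbb{F}^{1\times\ell}\langle x,x^*\rangle$ lies in $\mathbb{F}^{\ell\times1}I+I^*\mathbb{F}^{1\times\ell}$, each $p_i\in I$. $\sqrt[\mathrm{rr}]{I}$ is the smallest real left module containing $I$. *)

(* Defs.v *)
From HB Require Import structures.
From mathcomp Require Import all_boot all_order all_algebra.
From mathcomp Require Import ring lra.
From mathcomp Require Import boolp classical_sets reals.
From mathcomp Require Import complex.

Set Implicit Arguments.
Unset Strict Implicit.
Unset Printing Implicit Defensive.

Import Order.TTheory GRing.Theory Num.Theory.
Local Open Scope classical_set_scope.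
Local Open Scope ring_scope.

HB.mixin Record PzRing_isStarRing R of GRing.PzRing R := {
  star : R -> R;
  starD : {morph star : a b / a + b};
  starM : forall a b, star (a * b) = star b * star a;
  starK : involutive star
}.

#[short(type="starRingType")]
HB.structure Definition StarRing :=
  {R of GRing.PzRing R & PzRing_isStarRing R}.

Section StarTheory.
Variable F : starRingType.

Lemma star0 : star (0 : F) = 0.
Proof. by apply: (@addrI _ (star (0 : F))); rewrite -starD !addr0. Qed.

Lemma star1 : star (1 : F) = 1.
Proof. by rewrite -[LHS]mulr1 -[X in _ * X]starK -starM mulr1 starK. Qed.

Lemma starN (a : F) : star (- a) = - star a.
Proof. by apply/eqP; rewrite -addr_eq0 -starD addNr star0. Qed.

End StarTheory.

Definition central (F : pzRingType) (a : F) := forall b : F, a * b = b * a.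

Definition adjmx (F : starRingType) m n (A : 'M[F]_(m, n)) : 'M[F]_(n, m) :=
  map_mx star A^T.

Section RealStar.
Variable R : realType.
Let idM (a b : R) : idfun (a * b) = idfun b * idfun a.
Proof. exact: mulrC. Qed.
HB.instance Definition _ :=
  @PzRing_isStarRing.Build R idfun (fun _ _ => erefl) idM (fun=> erefl).
End RealStar.

Section ComplexStar.
Variable R : realType.
Let conjcM (a b : R[i]) : conjc (a * b) = conjc b * conjc a.
Proof. by rewrite rmorphM mulrC. Qed.
HB.instance Definition _ :=
  @PzRing_isStarRing.Build R[i] (@conjc R) (rmorphD (@conjc R)) conjcM
    (@conjcK R).
End ComplexStar.

(* [Quat a b c d] stands for a + b i + c j + d k. *)
Record quat (R : Type) := Quat { qre : R; qi : R; qj : R; qk : R }.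

Section Quaternions.
Variable R : realType.
Notation H := (quat R).
Implicit Types p q : H.

Definition quat_tuple p := (qre p, qi p, qj p, qk p).
Definition tuple_quat (t : R * R * R * R) : H :=
  let: (a, b, c, d) := t in Quat a b c d.
Lemma quat_tupleK : cancel quat_tuple tuple_quat. Proof. by case. Qed.
HB.instance Definition _ := Choice.copy H (can_type quat_tupleK).

Definition addquat p q :=
  Quat (qre p + qre q) (qi p + qi q) (qj p + qj q) (qk p + qk q).
Definition oppquat p := Quat (- qre p) (- qi p) (- qj p) (- qk p).
Definition mulquat p q := Quat
  (qre p * qre q - qi p * qi q - qj p * qj q - qk p * qk q)
  (qre p * qi q + qi p * qre q + qj p * qk q - qk p * qj q)
  (qre p * qj q - qi p * qk q + qj p * qre q + qk p * qi q)
  (qre p * qk q + qi p * qj q - qj p * qi q + qk p * qre q).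
Definition conjquat p := Quat (qre p) (- qi p) (- qj p) (- qk p).

Lemma addquatA : associative addquat.
Proof. by move=> p q r; rewrite /addquat /= !addrA. Qed.
Lemma addquatC : commutative addquat.
Proof. by move=> p q; congr Quat; apply: addrC. Qed.
Lemma add0quat : left_id (Quat 0 0 0 0) addquat.
Proof. by case=> *; rewrite /addquat /= !add0r. Qed.
Lemma addNquat : left_inverse (Quat 0 0 0 0) oppquat addquat.
Proof. by case=> *; rewrite /addquat /= !addNr. Qed.
HB.instance Definition _ :=
  GRing.isZmodule.Build H addquatA addquatC add0quat addNquat.

Lemma mulquatA : associative mulquat.
Proof. by move=> [????] [????] [????]; congr Quat => /=; ring. Qed.
Lemma mul1quat : left_id (Quat 1 0 0 0) mulquat.
Proof. by move=> [????]; congr Quat => /=; ring. Qed.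
Lemma mulquat1 : right_id (Quat 1 0 0 0) mulquat.
Proof. by move=> [????]; congr Quat => /=; ring. Qed.
Lemma mulquatDl : left_distributive mulquat addquat.
Proof. by move=> [????] [????] [????]; congr Quat => /=; ring. Qed.
Lemma mulquatDr : right_distributive mulquat addquat.
Proof. by move=> [????] [????] [????]; congr Quat => /=; ring. Qed.
HB.instance Definition _ :=
  GRing.Zmodule_isPzRing.Build H mulquatA mul1quat mulquat1 mulquatDl mulquatDr.

Lemma conjquatD : {morph conjquat : p q / p + q}.
Proof. by move=> [????] [????]; congr Quat => /=; ring. Qed.
Lemma conjquatM p q : conjquat (p * q) = conjquat q * conjquat p.
Proof. by case: p q => [????] [????]; congr Quat => /=; ring. Qed.
Lemma conjquatK : involutive conjquat.
Proof. by move=> [????]; rewrite /conjquat /= !opprK. Qed.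
HB.instance Definition _ :=
  PzRing_isStarRing.Build H conjquatD conjquatM conjquatK.

Lemma central_quatP p : central p <-> p = Quat (qre p) 0 0 0.
Proof.
split=> [|-> q]; last by congr Quat => /=; ring.
case: p => a b c d cp /=.
case: (cp (Quat 0 1 0 0)) => _ _ /= cj ck.
case: (cp (Quat 0 0 1 0)) => _ _ _ /= bk.
by congr Quat; lra.
Qed.

End Quaternions.

(* The letters: [inl i] is x_i and [inr i] is x_i^*. *)
Definition letter (g : nat) := ('I_g + 'I_g)%type.

Definition letter_star g (z : letter g) : letter g :=
  match z with inl i => inr i | inr i => inl i end.

Section NCPoly.
Variables (F : starRingType) (g : nat).

(* F<x,x^*> is presented as the ring generated by F and the letters, the only
   relations between F and the letters being that central elements of F commute
   with the letters.  If F is commutative this is the free F-algebra on the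
   letters.  The centre of the quaternions is the real line
   ([central_quatP]), so over them it is the free product over R of the
   quaternions with the free real algebra on the letters.
   [nceq] is the ring congruence generated by these relations; 0 and 1 are
   [NConst 0] and [NConst 1], and - t is [NConst (-1)] times t. *)
Inductive ncterm :=
| NConst of F
| NLetter of letter g
| NAdd of ncterm & ncterm
| NMul of ncterm & ncterm.

Inductive nceq : ncterm -> ncterm -> Prop :=
| nceq_refl t : nceq t t
| nceq_sym t u : nceq t u -> nceq u t
| nceq_trans t u w : nceq t u -> nceq u w -> nceq t w
| nceq_add t t' u u' : nceq t t' -> nceq u u' -> nceq (NAdd t u) (NAdd t' u')
| nceq_mul t t' u u' : nceq t t' -> nceq u u' -> nceq (NMul t u) (NMul t' u')
| nceq_addA t u w : nceq (NAdd t (NAdd u w)) (NAdd (NAdd t u) w)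
| nceq_addC t u : nceq (NAdd t u) (NAdd u t)
| nceq_add0 t : nceq (NAdd (NConst 0) t) t
| nceq_addN t : nceq (NAdd (NMul (NConst (-1)) t) t) (NConst 0)
| nceq_mulA t u w : nceq (NMul t (NMul u w)) (NMul (NMul t u) w)
| nceq_mul1l t : nceq (NMul (NConst 1) t) t
| nceq_mul1r t : nceq (NMul t (NConst 1)) t
| nceq_mulDl t u w : nceq (NMul (NAdd t u) w) (NAdd (NMul t w) (NMul u w))
| nceq_mulDr t u w : nceq (NMul t (NAdd u w)) (NAdd (NMul t u) (NMul t w))
| nceq_constD a b : nceq (NConst (a + b)) (NAdd (NConst a) (NConst b))
| nceq_constM a b : nceq (NConst (a * b)) (NMul (NConst a) (NConst b))
| nceq_central a z : central a ->
    nceq (NMul (NConst a) (NLetter z)) (NMul (NLetter z) (NConst a)).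

HB.instance Definition _ := gen_eqMixin ncterm.
HB.instance Definition _ := gen_choiceMixin ncterm.

Definition nceqb : rel ncterm := fun t u => `[< nceq t u >].

Lemma nceqb_equiv : equiv_class_of nceqb.
Proof.
split=> [t|t u|u t w].
- by apply/asboolP/nceq_refl.
- by apply/idP/idP => /asboolP /nceq_sym tu; apply/asboolP.
- by move=> /asboolP tu /asboolP uw; apply/asboolP/(nceq_trans tu).
Qed.
Canonical nceqb_canonical := EquivRelPack nceqb_equiv.

Local Open Scope quotient_scope.

Definition ncpoly := {eq_quot nceqb}.
HB.instance Definition _ := Choice.on ncpoly.
HB.instance Definition _ : EqQuotient _ nceqb ncpoly := EqQuotient.on ncpoly.

Lemma ncP t u : nceq t u <-> \pi_ncpoly t = \pi_ncpoly u.
Proof.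
split=> [tu|]; first by apply/eqmodP/asboolP.
by move=> /eqmodP/asboolP.
Qed.

Lemma nc_reprE t : nceq (repr (\pi_ncpoly t)) t.
Proof. by apply/ncP; rewrite reprK. Qed.

Definition ncC (a : F) : ncpoly := \pi_ncpoly (NConst a).
Definition ncX (z : letter g) : ncpoly := \pi_ncpoly (NLetter z).
Definition ncadd (p q : ncpoly) : ncpoly := \pi_ncpoly (NAdd (repr p) (repr q)).
Definition ncmul (p q : ncpoly) : ncpoly := \pi_ncpoly (NMul (repr p) (repr q)).
Definition ncopp (p : ncpoly) : ncpoly := ncmul (ncC (-1)) p.

Lemma pi_add t u : \pi_ncpoly (NAdd t u) = ncadd (\pi_ncpoly t) (\pi_ncpoly u).
Proof. by apply/ncP/nceq_add; apply/nceq_sym/nc_reprE. Qed.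
Lemma pi_mul t u : \pi_ncpoly (NMul t u) = ncmul (\pi_ncpoly t) (\pi_ncpoly u).
Proof. by apply/ncP/nceq_mul; apply/nceq_sym/nc_reprE. Qed.

Lemma ncpolyW (P : ncpoly -> Prop) :
  (forall t, P (\pi_ncpoly t)) -> forall p, P p.
Proof. by move=> H p; rewrite -[p]reprK. Qed.

Lemma ncaddA : associative ncadd.
Proof.
do 3!elim/ncpolyW=> ?; rewrite -!pi_add; exact/ncP/nceq_addA.
Qed.
Lemma ncaddC : commutative ncadd.
Proof. do 2!elim/ncpolyW=> ?; rewrite -!pi_add; exact/ncP/nceq_addC. Qed.
Lemma ncadd0 : left_id (ncC 0) ncadd.
Proof. elim/ncpolyW=> ?; rewrite -!pi_add; exact/ncP/nceq_add0. Qed.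
Lemma ncaddN : left_inverse (ncC 0) ncopp ncadd.
Proof.
by elim/ncpolyW=> ?; rewrite /ncopp /ncC -pi_mul -pi_add; apply/ncP/nceq_addN.
Qed.
HB.instance Definition _ :=
  GRing.isZmodule.Build ncpoly ncaddA ncaddC ncadd0 ncaddN.

Lemma ncmulA : associative ncmul.
Proof. do 3!elim/ncpolyW=> ?; rewrite -!pi_mul; exact/ncP/nceq_mulA. Qed.
Lemma ncmul1l : left_id (ncC 1) ncmul.
Proof. elim/ncpolyW=> ?; rewrite -!pi_mul; exact/ncP/nceq_mul1l. Qed.
Lemma ncmul1r : right_id (ncC 1) ncmul.
Proof. elim/ncpolyW=> ?; rewrite -!pi_mul; exact/ncP/nceq_mul1r. Qed.
Lemma ncmulDl : left_distributive ncmul ncadd.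
Proof.
by do 3!elim/ncpolyW=> ?; rewrite -!(pi_mul, pi_add); apply/ncP/nceq_mulDl.
Qed.
Lemma ncmulDr : right_distributive ncmul ncadd.
Proof.
by do 3!elim/ncpolyW=> ?; rewrite -!(pi_mul, pi_add); apply/ncP/nceq_mulDr.
Qed.
HB.instance Definition _ :=
  GRing.Zmodule_isPzRing.Build ncpoly ncmulA ncmul1l ncmul1r ncmulDl ncmulDr.

Lemma pi_ncD t u : \pi_ncpoly (NAdd t u) = \pi_ncpoly t + \pi_ncpoly u.
Proof. exact: pi_add. Qed.
Lemma pi_ncM t u : \pi_ncpoly (NMul t u) = \pi_ncpoly t * \pi_ncpoly u.
Proof. exact: pi_mul. Qed.

Lemma ncC0 : ncC 0 = 0. Proof. by []. Qed.
Lemma ncC1 : ncC 1 = 1. Proof. by []. Qed.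
Lemma ncCD : {morph ncC : a b / a + b}.
Proof. by move=> a b; rewrite -pi_ncD; apply/ncP/nceq_constD. Qed.
Lemma ncCM : {morph ncC : a b / a * b}.
Proof. by move=> a b; rewrite -pi_ncM; apply/ncP/nceq_constM. Qed.
HB.instance Definition _ :=
  GRing.isNmodMorphism.Build F ncpoly ncC (ncC0, ncCD).
HB.instance Definition _ :=
  GRing.isMonoidMorphism.Build F ncpoly ncC (ncC1, ncCM).

Lemma ncCX a z : central a -> ncC a * ncX z = ncX z * ncC a.
Proof. by move=> ca; rewrite -!pi_ncM; apply/ncP/nceq_central. Qed.

Lemma ncpoly_ind (P : ncpoly -> Prop) :
  (forall a, P (ncC a)) -> (forall z, P (ncX z)) ->
  (forall p q, P p -> P q -> P (p + q)) ->
  (forall p q, P p -> P q -> P (p * q)) ->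
  forall p, P p.
Proof.
move=> PC PX PD PM; elim/ncpolyW; elim=> [a|z|t Pt u Pu|t Pt u Pu].
- exact: PC.
- exact: PX.
- by rewrite pi_ncD; apply: PD.
- by rewrite pi_ncM; apply: PM.
Qed.

(* The substitution of f a for the scalar a and of y z for the letter z.  It is
   meaningful on [ncpoly] when central scalars have images commuting with the
   images of the letters, see [ncsubst_rmorphism]. *)
Section Subst.
Variables (S : pzRingType) (f : F -> S) (y : letter g -> S).

Fixpoint ncterm_subst (t : ncterm) : S :=
  match t with
  | NConst a => f a
  | NLetter z => y z
  | NAdd t u => ncterm_subst t + ncterm_subst u
  | NMul t u => ncterm_subst t * ncterm_subst u
  end.

Definition ncsubst (p : ncpoly) : S := ncterm_subst (repr p).

End Subst.

Section SubstTheory.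
Variables (S : pzRingType) (f : {rmorphism F -> S}) (y : letter g -> S).
Hypothesis fy : forall a z, central a -> f a * y z = y z * f a.

Lemma ncterm_substP t u : nceq t u -> ncterm_subst f y t = ncterm_subst f y u.
Proof.
elim=> //=.
- by move=> ? ? ? _ -> _ ->.
- by move=> ? ? ? ? _ -> _ ->.
- by move=> ? ? ? ? _ -> _ ->.
- by move=> *; apply: addrA.
- by move=> *; apply: addrC.
- by move=> *; rewrite rmorph0 add0r.
- by move=> *; rewrite rmorphN1 mulN1r addNr rmorph0.
- by move=> *; apply: mulrA.
- by move=> *; rewrite rmorph1 mul1r.
- by move=> *; rewrite rmorph1 mulr1.
- by move=> *; apply: mulrDl.
- by move=> *; apply: mulrDr.
- by move=> *; apply: rmorphD.
- by move=> *; apply: rmorphM.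
Qed.

Lemma ncsubst_pi t : ncsubst f y (\pi_ncpoly t) = ncterm_subst f y t.
Proof. exact/ncterm_substP/nc_reprE. Qed.

Lemma ncsubstC a : ncsubst f y (ncC a) = f a.
Proof. exact: ncsubst_pi. Qed.
Lemma ncsubstX z : ncsubst f y (ncX z) = y z.
Proof. exact: ncsubst_pi. Qed.
Lemma ncsubstD : {morph ncsubst f y : p q / p + q}.
Proof. by do 2!elim/ncpolyW=> ?; rewrite -pi_ncD !ncsubst_pi. Qed.
Lemma ncsubstM : {morph ncsubst f y : p q / p * q}.
Proof. by do 2!elim/ncpolyW=> ?; rewrite -pi_ncM !ncsubst_pi. Qed.

(* With [ncC] and [ncCX], the universal property of F<x,x^*>. *)
Lemma ncsubst_rmorphism (h : ncpoly -> S) :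
  [/\ {morph h : p q / p + q}, {morph h : p q / p * q},
      forall a, h (ncC a) = f a & forall z, h (ncX z) = y z]
  <-> h = ncsubst f y.
Proof.
split=> [[hD hM hC hX]|->].
  apply/funext; elim/ncpoly_ind => [a|z|p q hp hq|p q hp hq].
  - by rewrite hC ncsubstC.
  - by rewrite hX ncsubstX.
  - by rewrite hD ncsubstD hp hq.
  - by rewrite hM ncsubstM hp hq.
split; [exact: ncsubstD | exact: ncsubstM | exact: ncsubstC | exact: ncsubstX].
Qed.

End SubstTheory.

Fixpoint ncterm_star (t : ncterm) : ncterm :=
  match t with
  | NConst a => NConst (star a)
  | NLetter z => NLetter (letter_star z)
  | NAdd t u => NAdd (ncterm_star t) (ncterm_star u)
  | NMul t u => NMul (ncterm_star u) (ncterm_star t)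
  end.

Definition ncstar (p : ncpoly) : ncpoly := \pi_ncpoly (ncterm_star (repr p)).

Lemma central_star (a : F) : central a -> central (star a).
Proof. by move=> ca b; rewrite -[b]starK -!starM ca. Qed.

Lemma ncterm_starP t u : nceq t u -> nceq (ncterm_star t) (ncterm_star u).
Proof.
elim=> /=; rewrite ?(star0, star1, starN).
- by move=> *; apply: nceq_refl.
- by move=> *; apply: nceq_sym.
- by move=> ? u' ? _ H1 _ H2; apply: (nceq_trans H1).
- by move=> *; apply: nceq_add.
- by move=> *; apply: nceq_mul.
- by move=> *; apply: nceq_addA.
- by move=> *; apply: nceq_addC.
- by move=> *; apply: nceq_add0.
- move=> w; apply/ncP; rewrite pi_ncD pi_ncM -/(ncC _) -/(ncC _).
  by rewrite rmorphN1 mulrN1 addNr ncC0.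
- by move=> *; apply/nceq_sym/nceq_mulA.
- by move=> *; apply: nceq_mul1r.
- by move=> *; apply: nceq_mul1l.
- by move=> *; apply: nceq_mulDr.
- by move=> *; apply: nceq_mulDl.
- by move=> *; rewrite starD; apply: nceq_constD.
- by move=> *; rewrite starM; apply: nceq_constM.
- by move=> a z ca; apply/nceq_sym/nceq_central/central_star.
Qed.

Lemma ncstar_pi t : ncstar (\pi_ncpoly t) = \pi_ncpoly (ncterm_star t).
Proof. exact/ncP/ncterm_starP/nc_reprE. Qed.

Lemma ncstarD : {morph ncstar : p q / p + q}.
Proof.
by do 2!elim/ncpolyW=> ?; rewrite -pi_ncD !ncstar_pi -pi_ncD.
Qed.
Lemma ncstarM p q : ncstar (p * q) = ncstar q * ncstar p.
Proof.
elim/ncpolyW: p => ?; elim/ncpolyW: q => ?.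
by rewrite -pi_ncM !ncstar_pi -pi_ncM.
Qed.
Lemma ncstarK : involutive ncstar.
Proof.
elim/ncpolyW=> t; rewrite !ncstar_pi; congr (\pi_ncpoly _).
by elim: t => [a|[]//|? /= -> ? ->|? /= -> ? ->] //=; rewrite starK.
Qed.
HB.instance Definition _ :=
  PzRing_isStarRing.Build ncpoly ncstarD ncstarM ncstarK.

Lemma ncstarC a : star (ncC a) = ncC (star a).
Proof. exact: ncstar_pi. Qed.
Lemma ncstarX z : star (ncX z) = ncX (letter_star z).
Proof. exact: ncstar_pi. Qed.

End NCPoly.

Section Evaluation.
Variables (F : starRingType) (g n : nat) (X : 'I_g -> 'M[F]_n).

Definition eval_letter (z : letter g) : 'M[F]_n :=
  match z with inl i => X i | inr i => adjmx (X i) end.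

Definition nceval : ncpoly F g -> 'M[F]_n :=
  ncsubst (fun a : F => a%:M) eval_letter.

Lemma scalar_mx_central a z : central a ->
  a%:M * eval_letter z = eval_letter z * a%:M.
Proof.
move=> ca; apply/matrixP=> i j; rewrite !mxE (bigD1 i) //= big1 ?addr0.
  rewrite (bigD1 j) //= big1 ?addr0; first by rewrite !mxE !eqxx ca.
  by move=> k kj; rewrite !mxE (negbTE kj) mulr0.
by move=> k ki; rewrite !mxE eq_sym (negbTE ki) mul0r.
Qed.

Lemma ncevalC a : nceval (ncC g a) = a%:M.
Proof. exact: (ncsubstC (f := @scalar_mx F n) scalar_mx_central). Qed.
Lemma ncevalX z : nceval (ncX F z) = eval_letter z.
Proof. exact: (ncsubstX (f := @scalar_mx F n) scalar_mx_central). Qed.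
Lemma ncevalD : {morph nceval : p q / p + q}.
Proof. exact: (ncsubstD (f := @scalar_mx F n) scalar_mx_central). Qed.
Lemma ncevalM : {morph nceval : p q / p * q >-> p *m q}.
Proof. exact: (ncsubstM (f := @scalar_mx F n) scalar_mx_central). Qed.

(* The row and column sizes are nu * n and l * n, written as the sums
   \sum_(i < nu) n and \sum_(j < l) n of the sizes of the blocks. *)
Definition ncevalmx nu l (p : 'M[ncpoly F g]_(nu, l)) :=
  \mxblock_(i < nu, j < l) nceval (p i j).

End Evaluation.

Section LeftModules.
Variables (F : starRingType) (g : nat).
Notation A := (ncpoly F g).

Definition additive_subgroup (V : zmodType) (G : set V) :=
  G 0 /\ forall a b, G a -> G b -> G (a - b).

Definition additive_span (V : zmodType) (B : set V) : set V :=
  smallest (@additive_subgroup V) B.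

Definition mulset m n o (B : set 'M[A]_(m, n)) (C : set 'M[A]_(n, o)) :
    set 'M[A]_(m, o) :=
  additive_span [set b *m c | b in B & c in C].

Definition addset m n (B C : set 'M[A]_(m, n)) : set 'M[A]_(m, n) :=
  [set b + c | b in B & c in C].

Definition adjset m n (B : set 'M[A]_(m, n)) : set 'M[A]_(n, m) :=
  [set adjmx b | b in B].

(* F^{m x n}, inside the matrices over F<x,x^*>. *)
Definition constmxs m n : set 'M[A]_(m, n) :=
  range (map_mx (@ncC F g) : 'M[F]_(m, n) -> _).
Arguments constmxs : clear implicits.

Variable l : nat.
Implicit Type I : set 'rV[A]_l.

Definition left_module I :=
  [/\ I 0, (forall u v, I u -> I v -> I (u + v))
    & forall (a : A) u, I u -> I (a *: u)].

Definition real_left_module I := left_module I /\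
  forall (m : nat) (f : 'I_m -> 'rV[A]_l),
    addset (mulset (constmxs l 1) I) (mulset (adjset I) (constmxs 1 l))
      (\sum_i adjmx (f i) *m f i) ->
    forall i, I (f i).

Definition rrad I : set 'rV[A]_l := smallest real_left_module I.

(* The left module generated by the rows of all the p_i, i.e. the sum over i of
   F^{1 x nu_i}<x,x^*> p_i. *)
Definition row_module k (nu : 'I_k -> nat)
    (p : forall i, 'M[A]_(nu i, l)) : set 'rV[A]_l :=
  range (fun a : (forall i, 'rV[A]_(nu i)) => \sum_i a i *m p i).

Definition Jset k (nu : 'I_k -> nat) (p : forall i, 'M[A]_(nu i, l)) m :
    set 'M[A]_(m, l) :=
  mulset (constmxs m 1) (rrad (row_module p)).

Lemma mulset_constP I m (q : 'M[A]_(m, l)) : left_module I ->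
  mulset (constmxs m 1) I q <-> forall i, I (row i q).
Proof.
move=> [I0 ID IZ]; split=> [|Iq].
  pose G := [set w : 'M[A]_(m, l) | forall i, I (row i w)].
  apply: (smallest_sub (X := G)) => [|_ [_ [c _ <-]] [u Iu <-] i /=].
    split=> [i /=|a b Ga Gb i /=]; first by rewrite row0.
    by rewrite linearB /= -scaleN1r; apply: ID (Ga i) (IZ _ _ (Gb i)).
  rewrite row_mul [row i _]mx11_scalar; move: (row i _ 0 0) => a.
  have -> : a%:M *m u = a *: u.
    by apply/rowP=> j; rewrite !mxE big_ord1 !mxE eqxx.
  exact: IZ.
move=> G [[G0 GB] subG].
have GD a b : G a -> G b -> G (a + b).
  move=> Ga Gb; rewrite -[b]opprK; apply: (GB _ _ Ga).
  by rewrite -sub0r; apply: (GB).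
have -> : q = \sum_i map_mx (@ncC F g) (delta_mx i 0 : 'cV_m) *m row i q.
  apply/matrixP=> i j; rewrite summxE (bigD1 i) //= big1 => [|k ki].
    by rewrite !mxE big_ord1 !mxE !eqxx ncC1 mul1r addr0.
  by rewrite !mxE big_ord1 !mxE eq_sym (negbTE ki) ncC0 mul0r.
apply: (@big_ind _ G 0 +%R G0 GD) => i _; apply: subG.
exists (map_mx (@ncC F g) (delta_mx i 0)); first by exists (delta_mx i 0).
by exists (row i q).
Qed.

Lemma mulset_sub m n o (B B' : set 'M[A]_(m, n)) (C C' : set 'M[A]_(n, o)) :
  B `<=` B' -> C `<=` C' -> mulset B C `<=` mulset B' C'.
Proof.
move=> BB CC w Hw G [GG subG]; apply: Hw; split=> // _ [b Bb [c Cc <-]].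
by apply: subG; exists b; [exact: BB | exists c => //; exact: CC].
Qed.

Lemma rrad_real I : real_left_module (rrad I).
Proof.
split; first split.
- by move=> B [[[B0 _ _] _] _].
- move=> u v Iu Iv B BI; case: (BI) => [[[_ BD _] _] _].
  exact: (BD u v (Iu B BI) (Iv B BI)).
- move=> a u Iu B BI; case: (BI) => [[[_ _ BZ] _] _].
  exact: (BZ a u (Iu B BI)).
move=> m f Hf i B BI; case: (BI) => [[_ BR] _]; apply: (BR m f) => //.
have sub : rrad I `<=` B by move=> u; apply.
case: Hf => b Hb [c Hc <-]; exists b; last exists c => //.
  by apply: mulset_sub Hb.
by apply: mulset_sub Hc => // _ [u Iu <-]; exists u => //; apply: sub.
Qed.

End LeftModules.
Arguments constmxs F g m n : clear implicits.
Arguments Jset {F g l k nu} p m.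

(* Main.v *)
Require Import Defs.
From HB Require Import structures.
From mathcomp Require Import all_boot all_order all_algebra.
From mathcomp Require Import ring lra.
From mathcomp Require Import boolp classical_sets reals topology normedtype derive.
From mathcomp Require Import complex.

Set Implicit Arguments.
Unset Strict Implicit.
Unset Printing Implicit Defensive.

Import Order.TTheory GRing.Theory Num.Theory.
Import numFieldNormedType.Exports.
Local Open Scope ring_scope.

(** Let I be a real left module.  Realness says that a positive semidefinite
matrix whose Gram combination of rows of degree at most n+1 lies in I + I^*
only involves rows in I; separating these matrices from the positive
semidefinite cone yields a form that is positive definite modulo I in degree at
most n+1 and for which the multiplications by a letter and by its adjoint are
adjoint to each other.  Compressing them to degree at most n gives a
finite-dimensional real *-representation, with a vector whose annihilator in
degree at most n is I.  Finally the real matrices are turned into matrices over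
F on which the scalars act as scalar matrices. *)

(** A real left module usually has infinite codimension, so no finite-dimensional quotient carries
    the letters; this forces the truncation. A letter raises the degree by one, and the form must
    compare the pairing of [x f] with [h] to that of [f] with [x^* h] for [f], [h] of degree at most
    n: hence the extra degree. A polynomial of degree at most n applied to a constant row never
    leaves degree n, so the compression does not spoil its value.

    The linear algebra is done over R because R is central in all three choices of F, whereas
    quaternions need not commute with the letters. On the resulting real space the scalars are only
    operators [rho a], while evaluation demands [a%:M]; this mismatch is what the last step repairs,
    by a construction that depends on F.

    The converse implication rests on one remark: the rows annihilating a given pair (X,v) form a
    real left module, which therefore contains the real radical as soon as it contains the rows of
    the p_i. *)

Section LinearAlgebra.
Variable R : realType.

(** Among the matrices whose rows satisfy [P], take one of maximal rank: adjoining a further vector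
    of [P] cannot enlarge its row space. *)
Lemma subspace_mx n (P : 'rV[R]_n -> Prop) :
  P 0 -> (forall (a : R) u v, P u -> P v -> P (a *: u + v)) ->
  exists A : 'M[R]_n, forall v, P v <-> (v <= A)%MS.
Proof.
move=> P0 Plin.
have PA (A : 'M[R]_n) : (forall i, P (row i A)) -> forall v, (v <= A)%MS -> P v.
  move=> PA v /submxP[w ->]; rewrite mulmx_sum_row.
  apply: (@big_ind _ P); [exact: P0| |].
    by move=> u u' Pu Pu'; rewrite -[u]scale1r; apply: (Plin).
  by move=> i _; rewrite -[X in P X]addr0; apply: (Plin).
pose Q r := `[< exists A : 'M[R]_n, (forall i, P (row i A)) /\ \rank A = r >].
have exQ : exists r, Q r.
  exists 0; apply/asboolP; exists 0; split; last exact: mxrank0.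
  by move=> i; rewrite row0.
have Qle r : Q r -> (r <= n)%N by move=> /asboolP[A [_ <-]]; apply: rank_leq_row.
case: (ex_maxnP exQ Qle) => r /asboolP[A [PrA rA]] rmax.
exists A => v; split=> [Pv|]; last exact: PA.
pose B := (A + v)%MS.
have PB i : P (row i B).
  have /sub_addsmxP[[u1 u2] ->] : (row i B <= A + v)%MS by apply: row_sub.
  rewrite -[X in P (X + _)]scale1r; apply: (Plin); first exact/(PA A)/submxMl.
  rewrite [u2]mx11_scalar mul_scalar_mx -[X in P X]addr0.
  exact: (Plin).
have /rmax : Q (\rank B) by apply/asboolP; exists B.
rewrite -rA => rBA.
have /eqmxP AB : (A == A + v)%MS.
  by rewrite -mxrank_leqif_eq ?addsmxSl // eqn_leq rBA mxrankS ?addsmxSl.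
by rewrite AB addsmxSr.
Qed.

(** * Frobenius norm, reflections and Gram matrices *)

Definition sumsq m n (A : 'M[R]_(m, n)) : R := \sum_i \sum_j A i j ^+ 2.

Lemma sumsq_ge0 m n (A : 'M[R]_(m, n)) : 0 <= sumsq A.
Proof. by apply: sumr_ge0 => i _; apply: sumr_ge0 => j _; apply: sqr_ge0. Qed.

Lemma sumsq_eq0 m n (A : 'M[R]_(m, n)) : (sumsq A == 0) = (A == 0).
Proof.
apply/eqP/eqP => [|->]; last first.
  by rewrite /sumsq big1 // => i _; rewrite big1 // => j _; rewrite mxE expr0n.
move=> A0; apply/matrixP=> i j; rewrite mxE.
have ge0 i' : 0 <= \sum_j A i' j ^+ 2 by apply: sumr_ge0 => *; apply: sqr_ge0.
have /(_ i isT)/eqP := psumr_eq0P (fun i _ => ge0 i) A0.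
rewrite psumr_eq0 => [/allP /(_ j)|? _]; last exact: sqr_ge0.
by rewrite mem_index_enum => /(_ isT); rewrite sqrf_eq0 => /eqP.
Qed.

Lemma sumsq_tr m n (A : 'M[R]_(m, n)) : sumsq A = \tr (A^T *m A).
Proof.
rewrite /sumsq exchange_big; apply: eq_bigr => j _; rewrite !mxE.
by apply: eq_bigr => i _; rewrite mxE expr2.
Qed.

Lemma sumsq_row n (u : 'rV[R]_n) : u *m u^T = (sumsq u)%:M.
Proof. by rewrite sumsq_tr mxtrace_mulC trace_mx11 [LHS]mx11_scalar. Qed.

Lemma sumsqZ m n a (A : 'M[R]_(m, n)) : sumsq (a *: A) = a ^+ 2 * sumsq A.
Proof.
rewrite /sumsq mulr_sumr; apply: eq_bigr => i _; rewrite mulr_sumr.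
by apply: eq_bigr => j _; rewrite mxE exprMn.
Qed.

Lemma normalize m n (A : 'M[R]_(m, n)) :
  A != 0 -> sumsq ((Num.sqrt (sumsq A))^-1 *: A) = 1.
Proof.
rewrite -sumsq_eq0 => A0; rewrite sumsqZ exprVn sqr_sqrtr ?sumsq_ge0 //.
exact: mulVf.
Qed.

(** This is the Householder reflection along [w = u - e]; as [w *m w^T] is [2 - 2 * a], its
    coefficient 2/|w|^2 is [(1 - a)^-1]. When [a = 1] the vector [w] vanishes and the identity
    serves. *)
Lemma reflection n (u e : 'rV[R]_n) : sumsq u = 1 -> sumsq e = 1 ->
  exists H : 'M[R]_n, H^T *m H = 1%:M /\ e *m H = u.
Proof.
move=> u1 e1; pose w := u - e; pose a := (u *m e^T) 0 0.
have uu : u *m u^T = 1%:M by rewrite sumsq_row u1.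
have ee : e *m e^T = 1%:M by rewrite sumsq_row e1.
have ue : u *m e^T = a%:M by rewrite [LHS]mx11_scalar.
have eu : e *m u^T = a%:M by rewrite -[LHS]trmxK trmx_mul trmxK ue tr_scalar_mx.
have ww : w *m w^T = (2 - 2 * a)%:M.
  rewrite linearB /= !(mulmxBl, mulmxBr) uu ee ue eu -!raddfB /=.
  by congr (_%:M); ring.
have [a1|a1] := eqVneq a 1.
  exists 1%:M; rewrite trmx1 !mulmx1; split=> //; apply/esym/eqP.
  rewrite -subr_eq0 -/w -sumsq_eq0 sumsq_tr mxtrace_mulC ww a1.
  by rewrite mulr1 subrr mxtrace_scalar mul0rn.
have b0 : 1 - a != 0 by rewrite subr_eq0 eq_sym.
have ew : e *m w^T = (a - 1)%:M by rewrite linearB /= mulmxBr eu ee -raddfB.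
have [W [WT WW eW]] : exists W : 'M[R]_n,
    [/\ W^T = W, W *m W = (2 - 2 * a) *: W & e *m W = (a - 1) *: w].
  exists (w^T *m w); split; first by rewrite trmx_mul trmxK.
    by rewrite mulmxA -(mulmxA w^T) ww mul_mx_scalar -scalemxAl.
  by rewrite mulmxA ew mul_scalar_mx.
pose H := 1%:M - (1 - a)^-1 *: W.
have HT : H^T = H by rewrite /H linearB linearZ /= WT trmx1.
exists H; rewrite HT; split.
  rewrite /H mulmxBl mul1mx mulmxBr mulmx1 -scalemxAl -scalemxAr WW !scalerA.
  have -> : (1 - a)^-1 * (1 - a)^-1 * (2 - 2 * a) = 2 * (1 - a)^-1 by field.
  by rewrite mulr_natl mulr2n scalerDl opprB addrK subrK.
rewrite /H mulmxBr mulmx1 -scalemxAr eW scalerA.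
have -> : (1 - a)^-1 * (a - 1) = -1 by field.
by rewrite scaleN1r opprK addrC subrK.
Qed.

(* A reflection moving a unit vector of the left kernel of C to the last basis
   vector makes the last row of C vanish. *)
Lemma gram_reduce n (C : 'M[R]_(n + 1, n)) :
  exists C' : 'M[R]_n, C'^T *m C' = C^T *m C.
Proof.
have kC : kermx C != 0.
  rewrite kermx_eq0 /row_free neq_ltn (leq_ltn_trans (rank_leq_col C)) //.
  by rewrite addn1.
have [u u0 uC] : exists2 u : 'rV[R]_(n + 1), u != 0 & u *m C = 0.
  by case/rowV0Pn: kC => u /sub_kermxP; exists u.
pose e : 'rV[R]_(n + 1) := row_mx 0 1%:M.
have e1 : sumsq e = 1.
  rewrite sumsq_tr mxtrace_mulC /e tr_row_mx mul_row_col trmx0 mulmx0 add0r.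
  by rewrite trmx1 mulmx1 mxtrace1.
have [H [HH eH]] := reflection (normalize u0) e1.
have HC0 : dsubmx (H *m C) = 0.
  have -> : dsubmx (H *m C) = e *m (H *m C).
    by rewrite -[H *m C in RHS]vsubmxK mul_row_col mul0mx mul1mx add0r.
  by rewrite mulmxA eH -scalemxAl uC scaler0.
exists (usubmx (H *m C)).
have -> : C^T *m C = (H *m C)^T *m (H *m C).
  by rewrite trmx_mul mulmxA -(mulmxA _ _ H) HH mulmx1. 
rewrite -[in RHS](vsubmxK (H *m C)) HC0 tr_col_mx mul_row_col trmx0 mul0mx.
by rewrite addr0.
Qed.

(** * Minimisation over the unit sphere and separation from the positive semidefinite cone *)

Section Continuity.
Variables (T : topologicalType).

Lemma sum_continuous (I : finType) (f : I -> T -> R) :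
  (forall i, continuous (f i)) -> continuous (fun x => \sum_i f i x).
Proof.
move=> fc; elim: (index_enum I) => [|i r IH] x.
  by under eq_fun do rewrite big_nil; apply: cst_continuous.
by under eq_fun do rewrite big_cons; apply: continuousD; [apply: fc|apply: IH].
Qed.

Lemma mulmx_continuous m n p (f : T -> 'M[R]_(m, n)) (g : T -> 'M[R]_(n, p)) :
  (forall i j, continuous (fun x => f x i j)) ->
  (forall i j, continuous (fun x => g x i j)) ->
  forall i j, continuous (fun x => (f x *m g x) i j).
Proof.
move=> fc gc i j; under eq_fun do rewrite mxE.
by apply: sum_continuous => k x; apply: continuousM; [apply: fc|apply: gc].
Qed.

Lemma sumsq_continuous m n (f : T -> 'M[R]_(m, n)) :
  (forall i j, continuous (fun x => f x i j)) -> continuous (fun x => sumsq (f x)).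
Proof.
move=> fc; apply: sum_continuous => i; apply: sum_continuous => j x.
by under eq_fun do rewrite expr2; apply: continuousM; apply: fc.
Qed.

End Continuity.

Lemma sumsq_entry m n (A : 'M[R]_(m, n)) i j : A i j ^+ 2 <= sumsq A.
Proof.
rewrite /sumsq (bigD1 i) //= (bigD1 j) //= -addrA lerDl addr_ge0 //.
  by apply: sumr_ge0 => *; apply: sqr_ge0.
by apply: sumr_ge0 => *; apply: sumr_ge0 => *; apply: sqr_ge0.
Qed.

(** The sphere is compact, and nonempty because the size is [n.+1]. Continuity is asked along
    [vec_mx] since the extreme value theorem is applied to row vectors. *)
Lemma sphere_min n (f : 'M[R]_n.+1 -> R) :
  continuous (fun v => f (vec_mx v)) ->
  exists2 C, sumsq C = 1 & forall D, sumsq D = 1 -> f C <= f D.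
Proof.
move=> fc; pose S := [set v : 'rV[R]_(n.+1 * n.+1) | sumsq (vec_mx v) = 1]%classic.
have vecc i j : continuous (fun v : 'rV[R]_(n.+1 * n.+1) => vec_mx v i j).
  by under eq_fun do rewrite mxE; apply: coord_continuous.
have Sclosed : closed S.
  rewrite (_ : S = (fun v => sumsq (vec_mx v)) @^-1` [set x | x = 1])%classic //.
  apply: preimage_closed; last exact: closed_eq.
  by move=> v _; apply: sumsq_continuous.
have Sbounded : bounded_set S.
  exists 1; split; first exact: real1.
  move=> M M1 v /= vS; apply: le_trans (ltW M1).
  rewrite [leLHS]/Num.norm /= mx_normrE; apply/bigmax_leP; split=> // -[i j] _ /=.
  rewrite ord1 -[v]vec_mxK; case/mxvec_indexP: j => a b; rewrite mxvecE.
  by rewrite -[leRHS]sqrtr1 -sqrtr_sqr ler_sqrt // -vS sumsq_entry.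
have S0 : (S !=set0)%classic.
  have d0 : delta_mx ord0 ord0 != 0 :> 'M[R]_n.+1.
    by apply/eqP => /matrixP/(_ ord0 ord0)/eqP; rewrite !mxE oner_eq0.
  have := normalize d0; set D := (_ *: _) => D1.
  by exists (mxvec D); rewrite /S /= mxvecK.
have [v vS vmin] := EVT_min_rV S0 (bounded_closed_compact Sbounded Sclosed)
  (continuous_subspaceT fc).
exists (vec_mx v) => [|D D1]; first by move: vS; rewrite inE.
by have := vmin (mxvec D); rewrite mxvecK; apply; rewrite inE /S /= mxvecK.
Qed.

Lemma mxvec_tr m n (A B : 'M[R]_(m, n)) :
  mxvec A *m (mxvec B)^T = (\tr (A^T *m B))%:M.
Proof.
rewrite [LHS]mx11_scalar; congr (_%:M); rewrite mxE /mxtrace.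
under [RHS]eq_bigr do (rewrite mxE; under eq_bigr do rewrite mxE).
rewrite exchange_big pair_bigA (reindex _ (curry_mxvec_bij m n)) /=.
by apply: eq_bigr => -[i j] _; rewrite mxE !mxvecE.
Qed.

Lemma sumsq_lin n (u v : 'rV[R]_n) (a b : R) :
  sumsq (a *: u + b *: v) =
  a ^+ 2 * sumsq u + 2 * a * b * (u *m v^T) 0 0 + b ^+ 2 * sumsq v.
Proof.
rewrite /sumsq !big_ord1 mxE !mulr_sumr -!big_split.
by apply: eq_bigr => j _; rewrite !mxE /=; ring.
Qed.

(* With E a cokernel matrix of K, the squared distance of C^T C to K is
   minimised over the unit sphere; by convexity the residual at a minimiser is
   positive on every c^T c. *)
Lemma separating_form n (K : 'M[R]_n -> Prop) :
  K 0 -> (forall (a : R) S T, K S -> K T -> K (a *: S + T)) ->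
  (forall C : 'M[R]_n, K (C^T *m C) -> C = 0) ->
  exists B : 'M[R]_n, (forall S, K S -> \tr (B *m S) = 0) /\
    forall c : 'rV[R]_n, c != 0 -> 0 < (c *m B *m c^T) 0 0.
Proof.
move=> K0 Klin Kpos.
have [A KA] : exists A : 'M[R]_(n * n), forall v, K (vec_mx v) <-> (v <= A)%MS.
  apply: subspace_mx => [|a u v]; first by rewrite linear0.
  by rewrite linearP; apply: Klin.
(* In size 0 the unit sphere is empty, but both claims are trivial. *)
case: n K K0 Klin Kpos A KA => [|n] K K0 Klin Kpos A KA.
  by exists 0; split=> [S _|c]; [rewrite mul0mx mxtrace0|rewrite thinmx0 eqxx].
pose E := cokermx A.
have KE S : K S <-> mxvec S *m E = 0.
  by rewrite -[in K S](mxvecK S) KA submxE; split=> /eqP.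
pose f (C : 'M[R]_n.+1) := sumsq (mxvec (C^T *m C) *m E).
have [C C1 Cmin] : exists2 C, sumsq C = 1 & forall D, sumsq D = 1 -> f C <= f D.
  apply: sphere_min; rewrite /f; apply: sumsq_continuous.
  apply: mulmx_continuous => [i j|i j]; last exact: cst_continuous.
  rewrite ord1; case/mxvec_indexP: j => a b; under eq_fun do rewrite mxvecE.
  by apply: mulmx_continuous => c d; under eq_fun do rewrite !mxE;
    apply: coord_continuous.
pose beta := mxvec (C^T *m C) *m E.
have beta0 : 0 < sumsq beta.
  rewrite lt_def sumsq_ge0 sumsq_eq0 andbT; apply/eqP => /KE/Kpos C0.
  by have := oner_neq0 R; rewrite -C1 sumsq_eq0 C0 eqxx.
(* Chosen so that [\tr (B *m S)] is the inner product of the residual [beta] of the minimiser with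
   the residual of [S], which is 0 on [K]. *)
pose B := (vec_mx (beta *m E^T))^T.
have BE S : \tr (B *m S) = (beta *m (mxvec S *m E)^T) 0 0.
  have : beta *m (mxvec S *m E)^T = mxvec (vec_mx (beta *m E^T)) *m (mxvec S)^T.
    by rewrite vec_mxK trmx_mul mulmxA.
  by rewrite mxvec_tr -/B => ->; rewrite mxE eqxx.
exists B; split=> [S /KE KS|c c0].
  by rewrite BE KS trmx0 mulmx0 mxE.
pose c1 := (Num.sqrt (sumsq c))^-1 *: c.
have c11 : sumsq c1 = 1 := normalize c0.
suff : 0 < (c1 *m B *m c1^T) 0 0.
  rewrite linearZ /= -!scalemxAl -scalemxAr scalerA mxE -expr2.
  by rewrite pmulr_rgt0 // exprn_gt0 // invr_gt0 sqrtr_gt0 lt_def sumsq_ge0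
    sumsq_eq0 c0.
clearbody c1; rewrite -trace_mx11 mxtrace_mulC mulmxA mxtrace_mulC BE.
pose eta := mxvec (c1^T *m c1) *m E; rewrite -/eta.
pose d := (beta *m eta^T) 0 0; rewrite -/d.
(* [f] is convex in [C^T *m C], not in [C], so the segment is drawn between Gram matrices. Stacking
   the scaled factors realises its points with one row too many; [gram_reduce] removes that row, and
   the trace, hence [sumsq D], stays 1. *)
have Dt t : 0 <= t <= 1 ->
    sumsq beta <= (1 - t) ^+ 2 * sumsq beta + 2 * t * (1 - t) * d
                  + t ^+ 2 * sumsq eta.
  move=> /andP[t0 t1].
  have [D DD] := gram_reduce
    (col_mx (Num.sqrt (1 - t) *: C) (Num.sqrt t *: c1)).
  have {}DD : D^T *m D = (1 - t) *: (C^T *m C) + t *: (c1^T *m c1).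
    rewrite DD tr_col_mx mul_row_col !linearZ /= -!scalemxAl !scalerA.
    by rewrite -!expr2 !sqr_sqrtr // subr_ge0.
  have D1 : sumsq D = 1.
    by rewrite sumsq_tr DD linearD !linearZ /= -!sumsq_tr C1 c11 !mulr1 subrK.
  have := Cmin _ D1; rewrite /f -/beta DD.
  rewrite linearD !linearZ /= mulmxDl -!scalemxAl -/beta -/eta => /le_trans; apply.
  by rewrite sumsq_lin -/d; lra.
have [//|d0] := ltP 0 d.
have h0 := sumsq_ge0 eta.
pose M := sumsq beta - 2 * d + sumsq eta; pose e := sumsq beta - d.
have e0 : 0 < e by rewrite /e; lra.
have M0 : 0 <= M by rewrite /M; lra.
have eM : 0 < e + M by lra.
(* Along the segment the value is |beta|^2 - 2te + t^2 M with M = |beta - eta|^2. Its minimiser e/M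
   may exceed 1; the choice e/(e + M) stays in (0,1] and still gives |beta|^2 - te - t^2 e, below
   the minimum. *)
pose t := e / (e + M).
have tM : t * (e + M) = e by rewrite /t divfK // gt_eqF.
have t0 : 0 < t by apply: divr_gt0.
have t1 : t <= 1 by rewrite /t ler_pdivrMr // mul1r; lra.
have /Dt : 0 <= t <= 1 by rewrite ltW.
have -> : (1 - t) ^+ 2 * sumsq beta + 2 * t * (1 - t) * d + t ^+ 2 * sumsq eta =
  sumsq beta - t * e + t * (t * (e + M) - e) - t * t * e by rewrite /M /e; ring.
rewrite tM subrr mulr0.
have := mulr_gt0 t0 e0; have := mulr_gt0 t0 (mulr_gt0 t0 e0); rewrite mulrA; lra.
Qed.
End LinearAlgebra.

Section Adjoint.
Variable S : starRingType.

Lemma star_sum (I : Type) (r : seq I) (P : pred I) (f : I -> S) :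
  star (\sum_(i <- r | P i) f i) = \sum_(i <- r | P i) star (f i).
Proof. by apply: (big_morph star (@starD S) (star0 S)). Qed.

Lemma adjmxK m n : cancel (@adjmx S m n) (@adjmx S n m).
Proof. by move=> A; apply/matrixP=> i j; rewrite !mxE starK. Qed.

Lemma adjmx0 m n : adjmx (0 : 'M[S]_(m, n)) = 0.
Proof. by apply/matrixP=> i j; rewrite !mxE star0. Qed.

Lemma adjmxD m n (A B : 'M[S]_(m, n)) : adjmx (A + B) = adjmx A + adjmx B.
Proof. by apply/matrixP=> i j; rewrite !mxE starD. Qed.

Lemma adjmxN m n (A : 'M[S]_(m, n)) : adjmx (- A) = - adjmx A.
Proof. by apply/matrixP=> i j; rewrite !mxE starN. Qed.

Lemma adjmxB m n (A B : 'M[S]_(m, n)) : adjmx (A - B) = adjmx A - adjmx B.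
Proof. by rewrite adjmxD adjmxN. Qed.

Lemma adjmx_sum m n (I : Type) (r : seq I) (P : pred I) (A : I -> 'M[S]_(m, n)) :
  adjmx (\sum_(i <- r | P i) A i) = \sum_(i <- r | P i) adjmx (A i).
Proof. by apply: (big_morph _ (@adjmxD m n) (@adjmx0 m n)). Qed.

Lemma adjmxM m n p (A : 'M[S]_(m, n)) (B : 'M[S]_(n, p)) :
  adjmx (A *m B) = adjmx B *m adjmx A.
Proof.
apply/matrixP=> i j; rewrite !mxE star_sum.
by apply: eq_bigr => k _; rewrite !mxE starM.
Qed.

Lemma adjmx_scalar n (a : S) : adjmx (a%:M : 'M[S]_n) = (star a)%:M.
Proof.
apply/matrixP=> i j; rewrite !mxE eq_sym.
by case: eqP => _; rewrite ?mulr1n ?mulr0n ?star0.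
Qed.

End Adjoint.

(** * The real linear structure on rows of polynomials *)

Section RealScalars.
Variables (R : realType) (F : starRingType) (iota : {rmorphism R -> F}).
Hypothesis iota_central : forall r, central (iota r).
Hypothesis star_iota : forall r, star (iota r) = iota r.
Variables (g l : nat).
Local Notation A := (ncpoly F g).
Local Notation vec := 'rV[A]_l.

Lemma ncC_iota_central r (a : A) : ncC g (iota r) * a = a * ncC g (iota r).
Proof.
elim/ncpoly_ind: a => [a|z|p q hp hq|p q hp hq].
- by rewrite -!ncCM iota_central.
- exact: ncCX.
- by rewrite mulrDl mulrDr hp hq.
- by rewrite mulrA hp -mulrA hq mulrA.
Qed.

(** Real scalars act as left multiplication by constants, so that closure of a left module under
    polynomial multiples covers them too. *)
Definition rscale m n (r : R) (f : 'M[A]_(m, n)) := ncC g (iota r) *: f.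

Section RscaleTheory.
Variables m n p : nat.
Implicit Types (f h : 'M[A]_(m, n)) (k : 'M[A]_(n, p)).

Lemma rscale0 f : rscale 0 f = 0. Proof. by rewrite /rscale !rmorph0 scale0r. Qed.
Lemma rscale1 f : rscale 1 f = f. Proof. by rewrite /rscale !rmorph1 scale1r. Qed.
Lemma rscaleN1 f : rscale (-1) f = - f.
Proof. by rewrite /rscale !rmorphN1 scaleN1r. Qed.
Lemma rscaler0 r : rscale r (0 : 'M[A]_(m, n)) = 0. Proof. exact: scaler0. Qed.
Lemma rscaleDl r s f : rscale (r + s) f = rscale r f + rscale s f.
Proof. by rewrite /rscale !rmorphD scalerDl. Qed.
Lemma rscaleDr r f h : rscale r (f + h) = rscale r f + rscale r h.
Proof. exact: scalerDr. Qed.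
Lemma rscaleN r f : rscale r (- f) = - rscale r f.
Proof. exact: scalerN. Qed.
Lemma rscaleA r s f : rscale r (rscale s f) = rscale (r * s) f.
Proof. by rewrite /rscale !rmorphM scalerA. Qed.
Lemma rscale_sumr (I : finType) r (f : I -> 'M[A]_(m, n)) :
  rscale r (\sum_i f i) = \sum_i rscale r (f i).
Proof. exact: scaler_sumr. Qed.
Lemma rscale_ncscale r a f : a *: rscale r f = rscale r (a *: f).
Proof. by rewrite /rscale !scalerA ncC_iota_central. Qed.
Lemma adjmx_rscale r f : adjmx (rscale r f) = rscale r (adjmx f).
Proof.
apply/matrixP=> i j; rewrite !mxE starM ncstarC star_iota.
by rewrite ncC_iota_central.
Qed.
Lemma mulmx_rscalel r f k : rscale r f *m k = rscale r (f *m k).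
Proof. by rewrite /rscale scalemxAl. Qed.
Lemma mulmx_rscaler r f k : f *m rscale r k = rscale r (f *m k).
Proof.
apply/matrixP=> i j; rewrite !mxE mulr_sumr; apply: eq_bigr => x _.
by rewrite !mxE !mulrA ncC_iota_central.
Qed.

End RscaleTheory.

Definition lincomb N (b : 'I_N -> vec) (c : 'rV[R]_N) : vec :=
  \sum_i rscale (c 0 i) (b i).

Section Lincomb.
Variables (N : nat) (b : 'I_N -> vec).

Lemma lincomb0 : lincomb b 0 = 0.
Proof. by apply: big1 => i _; rewrite mxE rscale0. Qed.
Lemma lincombD c d : lincomb b (c + d) = lincomb b c + lincomb b d.
Proof. by rewrite -big_split; apply: eq_bigr => i _; rewrite mxE rscaleDl. Qed.
Lemma lincombZ r c : lincomb b (r *: c) = rscale r (lincomb b c).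
Proof. by rewrite rscale_sumr; apply: eq_bigr => i _; rewrite mxE rscaleA. Qed.
Lemma lincombB c d : lincomb b (c - d) = lincomb b c - lincomb b d.
Proof. by rewrite -[- d]scaleN1r lincombD lincombZ rscaleN1. Qed.

Definition gram (S : 'M[R]_N) : 'M[A]_l :=
  \sum_i \sum_j rscale (S i j) (adjmx (b i) *m b j).

Lemma gram_lin r S T : gram (r *: S + T) = rscale r (gram S) + gram T.
Proof.
rewrite /gram rscale_sumr -big_split; apply: eq_bigr => i _.
rewrite rscale_sumr -big_split; apply: eq_bigr => j _.
by rewrite !mxE rscaleDl rscaleA.
Qed.

Lemma gram0 : gram 0 = 0.
Proof. by apply: big1 => i _; apply: big1 => j _; rewrite mxE rscale0. Qed.

Lemma gramD S T : gram (S + T) = gram S + gram T.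
Proof. by rewrite -[S]scale1r gram_lin rscale1 scale1r. Qed.

Lemma gramB S T : gram (S - T) = gram S - gram T.
Proof. by rewrite addrC -scaleN1r gram_lin rscaleN1 addrC. Qed.

Lemma gram_tr S : gram S^T = adjmx (gram S).
Proof.
rewrite /gram adjmx_sum exchange_big; apply: eq_bigr => i _.
rewrite adjmx_sum; apply: eq_bigr => j _.
by rewrite mxE adjmx_rscale adjmxM adjmxK.
Qed.

Lemma gram_rank1 c d : gram (c^T *m d) = adjmx (lincomb b c) *m lincomb b d.
Proof.
rewrite /lincomb adjmx_sum mulmx_suml; apply: eq_bigr => i _.
rewrite mulmx_sumr; apply: eq_bigr => j _; rewrite adjmx_rscale.
by rewrite mulmx_rscalel mulmx_rscaler rscaleA !mxE big_ord1 !mxE.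
Qed.

Lemma gram_sum m (S : 'I_m -> 'M[R]_N) : gram (\sum_i S i) = \sum_i gram (S i).
Proof. exact: (big_morph gram gramD gram0). Qed.

End Lincomb.

Inductive rspan (s : seq vec) : vec -> Prop :=
| rspan0 : rspan s 0
| rspan_cons r x f : x \in s -> rspan s f -> rspan s (rscale r x + f).

Lemma rspanD s f h : rspan s f -> rspan s h -> rspan s (f + h).
Proof.
by elim=> [|r x f' xs _ IH] sh; rewrite ?add0r -?addrA //; apply/rspan_cons/IH.
Qed.
Lemma rspanZ s r f : rspan s f -> rspan s (rscale r f).
Proof.
elim=> [|r' x f' xs _ IH]; first by rewrite rscaler0; apply: rspan0.
by rewrite rscaleDr rscaleA; apply: rspan_cons.
Qed.
Lemma rspanN s f : rspan s f -> rspan s (- f).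
Proof. by rewrite -rscaleN1; apply: rspanZ. Qed.
Lemma rspanB s f h : rspan s f -> rspan s h -> rspan s (f - h).
Proof. by move=> sf sh; apply/rspanD/rspanN. Qed.
Lemma mem_rspan s f : f \in s -> rspan s f.
Proof.
by move=> sf; rewrite -[f]addr0 -[f]rscale1; apply/rspan_cons/rspan0.
Qed.
Lemma rspan_sum s (I : finType) (f : I -> vec) :
  (forall i, rspan s (f i)) -> rspan s (\sum_i f i).
Proof. by move=> sf; apply: big_ind => //; [apply: rspan0|apply: rspanD]. Qed.
Lemma rspan_lincomb s N (b : 'I_N -> vec) c :
  (forall i, rspan s (b i)) -> rspan s (lincomb b c).
Proof. by move=> sb; apply: rspan_sum => i; apply/rspanZ. Qed.
Lemma rspan_sub s s' f :
  (forall x, x \in s -> rspan s' x) -> rspan s f -> rspan s' f.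
Proof.
move=> ss'; elim=> [|r x f' xs _ IH]; first exact: rspan0.
exact/rspanD/IH/rspanZ/ss'.
Qed.

(** [rep_central] mirrors [nceq_central]. Beyond the real line it matters for C, where it makes the
    complex structure commute with the letters. *)
Record star_rep N (rho : F -> 'M[R]_N) (X : letter g -> 'M[R]_N) : Prop :=
  StarRep {
  repD : {morph rho : a b / a + b};
  repM : {morph rho : a b / a * b >-> a *m b};
  rep_iota : forall r, rho (iota r) = r%:M;
  rep_star : forall a, rho (star a) = (rho a)^T;
  rep_letter : forall z, X (letter_star z) = (X z)^T;
  rep_central : forall a z, central a -> rho a *m X z = X z *m rho a }.

(** * Forms that are positive definite modulo a left module *)

Section ModI.
Variable I : set vec.
Hypothesis I_module : left_module I.

Let I0 : I 0. Proof. by case: I_module. Qed.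
Let ID u v : I u -> I v -> I (u + v). Proof. by case: I_module => _ + _; apply. Qed.
Let IZ a u : I u -> I (a *: u). Proof. by case: I_module => _ _; apply. Qed.
Let IN u : I u -> I (- u). Proof. by rewrite -scaleN1r; apply: IZ. Qed.
Let IB u v : I u -> I v -> I (u - v).
Proof. by move=> Iu Iv; apply/ID/IN. Qed.

(** A vector of [s] is kept only when it is not congruent modulo [I] to a combination of those
    already kept. *)
Lemma mod_basis (s : seq vec) : exists N (b : 'I_N -> vec),
  (forall c, I (lincomb b c) -> c = 0) /\
  forall f, rspan s f -> exists c, I (f - lincomb b c).
Proof.
suff [N [b [bfree bs]]] : exists N (b : 'I_N -> vec),
    (forall c, I (lincomb b c) -> c = 0) /\
    forall f, f \in s -> exists c, I (f - lincomb b c).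
  exists N, b; split=> // f; elim=> [|r x f' xs _ [c' Ic']].
    by exists 0; rewrite lincomb0 subr0.
  have [c Ic] := bs x xs; exists (r *: c + c').
  rewrite lincombD lincombZ opprD addrACA -rscaleN -rscaleDr.
  exact/ID/Ic'/IZ.
elim: s => [|x s [N [b [bfree bs]]]].
  by exists 0, (fun _ => 0); split=> // c _; apply/rowP=> -[].
have [[c Ic]|xb] := pselect (exists c, I (x - lincomb b c)).
  exists N, b; split=> // f; rewrite inE => /orP[/eqP ->|]; last exact: bs.
  by exists c.
pose b' (i : 'I_(1 + N)) := if split i is inr j then b j else x.
have b'E (c : 'rV_(1 + N)) :
    lincomb b' c = rscale (lsubmx c 0 0) x + lincomb b (rsubmx c).
  rewrite /lincomb big_split_ord big_ord1; congr (_ + _).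
    by rewrite /b' (unsplitK (inl _)) !mxE.
  by apply: eq_bigr => i _; rewrite /b' (unsplitK (inr _)) !mxE.
exists (1 + N)%N, b'; split=> [c|f].
  rewrite b'E; have [c0|c0] := eqVneq (lsubmx c 0 0) 0.
    rewrite c0 rscale0 add0r => /bfree cr; rewrite -[c]hsubmxK cr.
    by rewrite [lsubmx c]mx11_scalar c0 raddf0 row_mx0.
  move=> Ic; case: xb; exists (- (lsubmx c 0 0)^-1 *: rsubmx c).
  rewrite lincombZ -[- _^-1]mulN1r -rscaleA rscaleN1 opprK.
  by have := IZ (ncC g (iota (lsubmx c 0 0)^-1)) Ic;
    rewrite -/(rscale _ _) rscaleDr rscaleA mulVf // rscale1.
rewrite inE => /orP[/eqP ->|/bs[c Ic]].
  exists (row_mx 1%:M 0); rewrite b'E row_mxKl row_mxKr lincomb0 addr0.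
  by rewrite mxE eqxx rscale1 subrr.
exists (row_mx 0 c); rewrite b'E row_mxKl row_mxKr mxE rscale0 add0r.
exact: Ic.
Qed.

(** This is the set F^{l x 1} I + I^* F^{1 x l} from the definition of realness, with one matrix per
    summand in place of the additive spans. *)
Definition hermitian_part (M : 'M[A]_l) := exists U V : 'M[A]_l,
  [/\ forall i, I (row i U), forall i, I (row i V) & M = U + adjmx V].

Let I_row (c : 'cV[A]_l) u : I u -> forall i, I (row i (c *m u)).
Proof.
by move=> Iu i; rewrite row_mul [row i c]mx11_scalar mul_scalar_mx; apply: IZ.
Qed.

Lemma hermitian_lin r M N : hermitian_part M -> hermitian_part N ->
  hermitian_part (rscale r M + N).
Proof.
move=> [U [V [IU IV ->]]] [U' [V' [IU' IV' ->]]].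
exists (rscale r U + U'), (rscale r V + V'); split=> [i|i|].
- by rewrite linearD linearZ; exact: (ID (IZ _ (IU i)) (IU' i)).
- by rewrite linearD linearZ; exact: (ID (IZ _ (IV i)) (IV' i)).
- by rewrite adjmxD adjmx_rscale rscaleDr addrACA.
Qed.

Lemma hermitian0 : hermitian_part 0.
Proof. by exists 0, 0; split=> [i|i|]; rewrite ?row0 ?adjmx0 ?addr0. Qed.

Lemma hermitianD M N : hermitian_part M -> hermitian_part N ->
  hermitian_part (M + N).
Proof. by move=> hM hN; rewrite -[M]rscale1; apply: hermitian_lin. Qed.

Lemma hermitianZ r M : hermitian_part M -> hermitian_part (rscale r M).
Proof.
by move=> hM; rewrite -[rscale r M]addr0; apply/hermitian_lin/hermitian0.
Qed.

Lemma hermitianN M : hermitian_part M -> hermitian_part (- M).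
Proof. by rewrite -rscaleN1; apply: hermitianZ. Qed.

Lemma hermitian_adj M : hermitian_part M -> hermitian_part (adjmx M).
Proof.
by move=> [U [V [IU IV ->]]]; exists V, U; rewrite adjmxD adjmxK addrC.
Qed.

Lemma hermitian_mulr (c : 'cV[A]_l) u : I u -> hermitian_part (c *m u).
Proof.
move=> Iu; exists (c *m u), 0; split=> [|i|]; first exact: I_row.
  by rewrite row0.
by rewrite adjmx0 addr0.
Qed.

Lemma hermitian_mull u (f : vec) : I u -> hermitian_part (adjmx u *m f).
Proof.
move=> Iu; rewrite -[_ *m f]adjmxK; apply: hermitian_adj.
by rewrite adjmxM adjmxK; apply: hermitian_mulr.
Qed.

Lemma hermitian_gram f h f' h' : I (f - f') -> I (h - h') ->
  hermitian_part (adjmx f *m h - adjmx f' *m h').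
Proof.
move=> If Ih.
have -> : adjmx f *m h - adjmx f' *m h' =
    adjmx (f - f') *m h + adjmx f' *m (h - h').
  by rewrite adjmxB mulmxBl mulmxBr addrA subrK.
by apply: hermitianD; [apply: hermitian_mull|apply: hermitian_mulr].
Qed.

(** By the last clause [phi f h] depends only on the product f^* h. As (a f)^* h = f^* (a^* h), it
    makes multiplication by a and by a^* adjoint to each other wherever all four vectors stay in
    [W]. *)
Definition positive_form (W : vec -> Prop) (phi : vec -> vec -> R) :=
  [/\ forall f h, phi f h = phi h f,
      forall r f f' h, W f -> W f' ->
        phi (rscale r f + f') h = r * phi f h + phi f' h,
      forall f, W f -> ~ I f -> 0 < phi f f,
      forall f h, W f -> I f -> phi f h = 0 &
      forall f h f' h', W f -> W h -> W f' -> W h' ->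
        adjmx f *m h = adjmx f' *m h' -> phi f h = phi f' h'].

Hypothesis I_real : forall m (f : 'I_m -> vec),
  hermitian_part (\sum_i adjmx (f i) *m f i) -> forall i, I (f i).

Lemma positive_form_exists s : exists phi, positive_form (rspan s) phi.
Proof.
have [N [b [bfree bs]]] := mod_basis s.
have /choice[kappa kappaP] f : exists c, rspan s f -> I (f - lincomb b c).
  have [/bs[c Ic]|] := pselect (rspan s f); first by exists c.
  by exists 0.
have kappaE f c : rspan s f -> I (f - lincomb b c) -> kappa f = c.
  move=> /kappaP kf Ic; apply/eqP; rewrite -subr_eq0; apply/eqP/bfree.
  rewrite lincombB; have := IB Ic kf.
  by rewrite opprB addrC addrA subrK.
(* With the transpose added, [K] contains every antisymmetric matrix, which forces the separating
   form to be symmetric. The factor 2 that this puts on [C^T *m C] is divided out below. *)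
pose K S := hermitian_part (gram b (S + S^T)).
have [||C KC|B [BK Bpos]] := @separating_form _ _ K.
- by rewrite /K trmx0 addr0 gram0; apply: hermitian0.
- move=> r S T KS KT; rewrite /K linearD linearZ /= addrACA -scalerDr gram_lin.
  exact: hermitian_lin.
(* Splitting by the rows of [C] turns the Gram combination into a sum of p_k^* p_k, to which
   realness applies. *)
- have CE : C^T *m C = \sum_k (row k C)^T *m row k C.
    apply/matrixP=> i j; rewrite summxE !mxE; apply: eq_bigr => k _.
    by rewrite !mxE big_ord1 !mxE.
  have {}KC : hermitian_part
      (\sum_k adjmx (lincomb b (row k C)) *m lincomb b (row k C)).
    have := hermitianZ 2^-1 KC; rewrite trmx_mul trmxK gramD CE gram_sum.
    under eq_bigr do rewrite gram_rank1.
    rewrite -[X in rscale _ (X + X)]rscale1 -rscaleDl rscaleA mulVf ?rscale1 //.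
    by rewrite pnatr_eq0.
  by apply/row_matrixP => k; rewrite row0; apply/bfree/(I_real KC).
pose phi f h := (kappa f *m B *m (kappa h)^T) 0 0.
(* Two products f^* h whose symmetrised difference lies in I + I^* get the same value. Symmetry and
   the dependence on f^* h alone are both instances. *)
have KB c d c' d' (M := adjmx (lincomb b c) *m lincomb b d -
                        adjmx (lincomb b c') *m lincomb b d') :
    hermitian_part (M + adjmx M) ->
    (c *m B *m d^T) 0 0 = (c' *m B *m d'^T) 0 0.
  have -> : M = adjmx (gram b (d^T *m c - d'^T *m c')).
    by rewrite gramB !gram_rank1 adjmxB !adjmxM !adjmxK.
  rewrite adjmxK addrC -gram_tr -gramD => /BK.
  rewrite mulmxBr linearB /= !mulmxA ![\tr (_ *m _ *m _)]mxtrace_mulC !mulmxA.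
  by rewrite !trace_mx11 => /eqP; rewrite subr_eq0 => /eqP.
exists phi; split.
- move=> f h; apply: KB.
  by rewrite adjmxB !adjmxM !adjmxK addrC addrA subrK subrr; apply: hermitian0.
- move=> r f f' h sf sf'; rewrite /phi.
  rewrite (@kappaE (rscale r f + f') (r *: kappa f + kappa f')).
  + by rewrite !mulmxDl -!scalemxAl !mxE.
  + exact/rspanD/sf'/rspanZ.
  + rewrite lincombD lincombZ opprD addrACA -rscaleN -rscaleDr.
    exact/ID/kappaP/sf'/IZ/kappaP.
- move=> f sf nIf; apply: Bpos; apply: contra_notN nIf => /eqP k0.
  by have := kappaP _ sf; rewrite k0 lincomb0 subr0.
- move=> f h sf If; rewrite /phi (kappaE f 0) ?lincomb0 ?subr0 //.
  by rewrite !mul0mx mxE.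
- move=> f h f' h' sf sh sf' sh' E; apply: KB.
  set M := (X in X + _); suff hM : hermitian_part M.
    by apply: hermitianD => //; apply: hermitian_adj.
  have /hermitianN := hermitian_gram (kappaP _ sf) (kappaP _ sh).
  have := hermitian_gram (kappaP _ sf') (kappaP _ sh').
  move=> /hermitianD H /H; rewrite E opprB addrC addrA subrK; exact.
Qed.

Section Form.
Variables (s : seq vec) (phi : vec -> vec -> R).
Hypothesis phi_form : positive_form (rspan s) phi.

Lemma formC f h : phi f h = phi h f.
Proof. by case: phi_form. Qed.
Lemma form_lin r f f' h : rspan s f -> rspan s f' ->
  phi (rscale r f + f') h = r * phi f h + phi f' h.
Proof. by case: phi_form => _ + _ _ _; apply. Qed.
Lemma form_I f h : rspan s f -> I f -> phi f h = 0.
Proof. by case: phi_form => _ _ _ + _; apply. Qed.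
Lemma form_adj f h f' h' : rspan s f -> rspan s h -> rspan s f' -> rspan s h' ->
  adjmx f *m h = adjmx f' *m h' -> phi f h = phi f' h'.
Proof. by case: phi_form => _ _ _ _; apply. Qed.
Lemma formD f f' h : rspan s f -> rspan s f' ->
  phi (f + f') h = phi f h + phi f' h.
Proof. by move=> sf sf'; rewrite -{1}[f]rscale1 form_lin // mul1r. Qed.
Lemma formZ r f h : rspan s f -> phi (rscale r f) h = r * phi f h.
Proof.
move=> sf; rewrite -[rscale r f]addr0 form_lin //; last exact: rspan0.
by rewrite (form_I h (rspan0 s) I0) addr0.
Qed.
Lemma form_lincomb N (b : 'I_N -> vec) c h : (forall i, rspan s (b i)) ->
  phi (lincomb b c) h = \sum_i c 0 i * phi (b i) h.
Proof.
move=> sb; rewrite /lincomb.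
suff [_ ->] : rspan s (lincomb b c) /\ phi (lincomb b c) h =
    \sum_i c 0 i * phi (b i) h by [].
rewrite /lincomb; elim/big_rec2: _ => [|i y f _ [sf <-]].
  by split; [apply: rspan0|apply: form_I I0; apply: rspan0].
by split; [apply/rspanD/sf/rspanZ|rewrite form_lin].
Qed.
Lemma form_modI f f' h : rspan s f -> rspan s f' -> I (f - f') ->
  phi f h = phi f' h.
Proof.
move=> sf sf' If; rewrite -[f](subrK f') formD //; last exact: rspanB.
by rewrite form_I ?add0r //; apply: rspanB.
Qed.

Definition coords N (b : 'I_N -> vec) f : 'rV[R]_N := \row_i phi f (b i).

(** The remainder [y] is dropped if it lies in [I]; otherwise [phi y y] is positive and [y] can be
    normalised. Only the smaller span of [s'] gets a basis, so [coords] of a vector in the larger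
    span describes its orthogonal projection. *)
Lemma gram_schmidt s' : (forall x, x \in s' -> rspan s x) ->
  exists N (b : 'I_N -> vec), [/\ forall i, rspan s' (b i),
    forall i j, phi (b i) (b j) = (i == j)%:R &
    forall f, rspan s' f -> I (f - lincomb b (coords b f))].
Proof.
move=> s's; have ss' f : rspan s' f -> rspan s f by apply: rspan_sub.
suff [N [b [sb bb bs]]] : exists N (b : 'I_N -> vec),
   [/\ forall i, rspan s' (b i), forall i j, phi (b i) (b j) = (i == j)%:R &
    forall f, f \in s' -> I (f - lincomb b (coords b f))].
  exists N, b; split=> // f; elim=> [|r x f' xs sf' If'].
    rewrite (_ : coords b 0 = 0) ?lincomb0 ?subr0 //.
    by apply/rowP=> i; rewrite !mxE form_I //; apply: rspan0.
  have -> : coords b (rscale r x + f') = r *: coords b x + coords b f'.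
    by apply/rowP=> i; rewrite !mxE form_lin //; [apply: s's|apply: ss'].
  rewrite lincombD lincombZ opprD addrACA -rscaleN -rscaleDr.
  exact/ID/If'/IZ/bs.
elim: s' s's {ss'} => [|x s' IH] s's.
  by exists 0, (fun _ => 0); split=> // -[].
have [N [b [sb bb bs]]] : exists N (b : 'I_N -> vec),
   [/\ forall i, rspan s' (b i), forall i j, phi (b i) (b j) = (i == j)%:R &
    forall f, f \in s' -> I (f - lincomb b (coords b f))].
  by apply: IH => y ys; apply: s's; rewrite inE ys orbT.
have sub f : rspan s' f -> rspan (x :: s') f.
  by apply: rspan_sub => y ys; apply: mem_rspan; rewrite inE ys orbT.
have ss' f : rspan (x :: s') f -> rspan s f by apply: rspan_sub.
have sx' : rspan (x :: s') x by apply: mem_rspan; rewrite inE eqxx.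
have sx : rspan s x by apply: ss'.
pose y := x - lincomb b (coords b x).
have sy' : rspan (x :: s') y.
  by apply: rspanB => //; apply: rspan_lincomb => i; apply: sub.
have sy : rspan s y by apply: ss'.
have sbs i : rspan s (b i) by apply/ss'/sub.
have lb c j : phi (lincomb b c) (b j) = c 0 j.
  rewrite form_lincomb // (bigD1 j) //= big1 => [|i ij].
    by rewrite bb eqxx mulr1 addr0.
  by rewrite bb (negbTE ij) mulr0.
have yb j : phi y (b j) = 0.
  rewrite /y -rscaleN1 addrC form_lin //; last exact: rspan_lincomb.
  by rewrite lb mxE mulN1r addNr.
have [Iy|nIy] := pselect (I y).
  exists N, b; split=> // [i|f]; first exact: sub.
  by rewrite inE => /orP[/eqP ->|/bs].
have yy : 0 < phi y y by case: phi_form => _ _ + _ _; apply.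
pose a := Num.sqrt (phi y y); have a0 : a != 0 by rewrite gt_eqF // sqrtr_gt0.
pose z := rscale a^-1 y.
have sz' : rspan (x :: s') z by apply: rspanZ.
have sz : rspan s z by apply: ss'.
have zb j : phi z (b j) = 0 by rewrite formZ // yb mulr0.
have zz : phi z z = 1.
  rewrite formZ // formC formZ // mulrA -expr2 exprVn sqr_sqrtr ?ltW //.
  by rewrite mulVf // gt_eqF.
have zl c : phi (lincomb b c) z = 0.
  by rewrite form_lincomb // big1 // => i _; rewrite formC zb mulr0.
pose b' (i : 'I_(1 + N)) := if split i is inr j then b j else z.
have b'0 : b' (lshift N 0) = z by rewrite /b' (unsplitK (inl _)).
have b'1 i : b' (rshift 1 i) = b i by rewrite /b' (unsplitK (inr _)).
have b'E f : lincomb b' (coords b' f) =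
    rscale (phi f z) z + lincomb b (coords b f).
  rewrite /lincomb big_split_ord big_ord1 mxE b'0; congr (_ + _).
  by apply: eq_bigr => i _; rewrite !mxE b'1.
exists (1 + N)%N, b'; split.
- by move=> i; case: (split_ordP i) => j ->; rewrite ?ord1 ?b'0 ?b'1 //; apply: sub.
- move=> i j; case: (split_ordP i) => i' ->; case: (split_ordP j) => j' ->.
  + by rewrite !ord1 b'0 zz eqxx.
  + by rewrite ord1 b'0 b'1 zb eq_lrshift.
  + by rewrite ord1 b'0 b'1 formC zb eq_rlshift.
  + by rewrite !b'1 bb eq_rshift.
- move=> f; rewrite inE b'E => /orP[/eqP ->|fs'].
    have -> : phi x z = a.
      rewrite -[x](subrK (lincomb b (coords b x))) -/y formD //; last first.
        exact: rspan_lincomb.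
      rewrite zl addr0 formC formZ //.
      by rewrite -[X in _ * X](@sqr_sqrtr _ (phi y y)) ?ltW // expr2 mulKf.
    by rewrite rscaleA divff // rscale1 opprD addrA addrAC -/y subrr.
  suff -> : phi f z = 0 by rewrite rscale0 add0r; apply: bs.
  have sf : rspan s f by apply/ss'/sub/mem_rspan.
  rewrite -[RHS](zl (coords b f)); apply: form_modI (bs f fs') => //.
  exact: rspan_lincomb.
Qed.

End Form.

(** * The degree filtration and the truncated GNS construction *)

Section Filtration.
Variables (d : nat) (e : 'I_d -> F).
Hypothesis e_span : forall a, exists c : 'I_d -> R, a = \sum_i iota (c i) * e i.

(** Each degree needs a finite real spanning family, also when constants sit between the letters of
    a word. A constant [e i] is therefore put in front again after every letter. *)
Fixpoint degree_gens n : seq vec :=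
  match n with
  | 0 => [seq ncC g (e i) *: delta_mx 0 j | i <- enum 'I_d, j <- enum 'I_l]
  | n.+1 => degree_gens n ++
      [seq ncC g (e i) *: h | i <- enum 'I_d,
         h <- [seq ncX F z *: f | z <- enum {: letter g}, f <- degree_gens n]]
  end.

Definition degree_le n := rspan (degree_gens n).

(** Generators come in full families indexed by [i], which is why their span is stable under all
    constants on the left. *)
Lemma degree_gensP n x : x \in degree_gens n -> exists i h,
  x = ncC g (e i) *: h /\ forall i', ncC g (e i') *: h \in degree_gens n.
Proof.
elim: n x => [|n IH] x /=.
  move=> /allpairsP[[i j] [_ _ ->]]; exists i, (delta_mx 0 j); split=> // i'.
  by apply/allpairsP; exists (i', j); rewrite !mem_enum.
rewrite mem_cat => /orP[/IH[i [h [-> hn]]]|/allpairsP[[i h] [_ hn ->]]].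
  by exists i, h; split=> // i'; rewrite mem_cat hn.
exists i, h; split=> // i'; rewrite mem_cat; apply/orP; right.
by apply/allpairsP; exists (i', h); rewrite mem_enum.
Qed.

Lemma rspan_ncC s a h : (forall i, rspan s (ncC g (e i) *: h)) ->
  rspan s (ncC g a *: h).
Proof.
move=> sh; have [c ->] := e_span a; rewrite rmorph_sum scaler_suml.
by apply: rspan_sum => i; rewrite /= ncCM -scalerA; apply: rspanZ.
Qed.

Lemma degree_le_ncC n a f : degree_le n f -> degree_le n (ncC g a *: f).
Proof.
elim=> [|r x f' /degree_gensP[i [h [-> hn]]] _ IH].
  by rewrite scaler0; apply: rspan0.
rewrite scalerDr rscale_ncscale scalerA -ncCM; apply: rspanD IH; apply: rspanZ.
by apply: rspan_ncC => i'; apply: mem_rspan.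
Qed.

Lemma degree_leS n f : degree_le n f -> degree_le n.+1 f.
Proof.
by apply: rspan_sub => x xn; apply: mem_rspan; rewrite /= mem_cat xn.
Qed.

Lemma degree_le_mono m n f : (m <= n)%N -> degree_le m f -> degree_le n f.
Proof. by move=> /subnK <-; elim: (n - m)%N => // k IH /IH; apply: degree_leS. Qed.

Lemma degree_le_ncX n z f : degree_le n f -> degree_le n.+1 (ncX F z *: f).
Proof.
elim=> [|r x f' xn _ IH]; first by rewrite scaler0; apply: rspan0.
rewrite scalerDr rscale_ncscale; apply: rspanD IH; apply: rspanZ.
rewrite -[_ *: x]scale1r -(rmorph1 (@ncC F g)); apply: rspan_ncC => i.
apply: mem_rspan; rewrite /= mem_cat; apply/orP; right.
apply/allpairsP; exists (i, ncX F z *: x); rewrite mem_enum; split=> //.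
by apply/allpairsP; exists (z, x); rewrite mem_enum.
Qed.

Lemma degree_le_delta j : degree_le 0 (delta_mx 0 j).
Proof.
rewrite -[delta_mx _ _]scale1r -(rmorph1 (@ncC F g)); apply: rspan_ncC => i.
by apply: mem_rspan; apply/allpairsP; exists (i, j); rewrite !mem_enum.
Qed.

(** In [gns_wX] the product may leave [D], where [w] no longer detects membership in [I]; the two
    properties combine only while the degree stays within the bound. *)
Record gns_rep N (D : vec -> Prop) (rho : F -> 'M[R]_N)
    (X : letter g -> 'M[R]_N) (w : vec -> 'cV[R]_N) : Prop := GnsRep {
  gns_star_rep : star_rep rho X;
  gns_wD : forall f h, D f -> D h -> w (f + h) = w f + w h;
  gns_wC : forall a f, D f -> w (ncC g a *: f) = rho a *m w f;
  gns_wX : forall z f, D f -> w (ncX F z *: f) = X z *m w f;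
  gns_w_eq0 : forall f, D f -> w f = 0 <-> I f }.

(* The positive form lives on degree n+1 while the space carries only degree n:
   compressing the multiplication by a letter to degree n makes it an operator
   whose transpose is the compression of the multiplication by its adjoint. *)
Lemma gns n : exists N rho X w, @gns_rep N (degree_le n) rho X w.
Proof.
have [phi phiP] := positive_form_exists (degree_gens n.+1).
have [|N [b [sb bb bs]]] := @gram_schmidt _ _ phiP (degree_gens n).
  by move=> x xn; apply/degree_leS/mem_rspan.
pose W := degree_le n.+1.
have Wb i : W (b i) by apply: degree_leS.
have Wn f : degree_le n f -> W f := @degree_leS n f.
have WC a f : W f -> W (ncC g a *: f) := @degree_le_ncC n.+1 a f.
have WX z f : degree_le n f -> W (ncX F z *: f) := @degree_le_ncX n z f.
(* For [f] of degree n+1 these are the coordinates of its [phi]-orthogonal projection to degree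
   n. *)
pose w f : 'cV_N := (coords phi b f)^T.
pose rho a : 'M_N := \matrix_(i, j) phi (ncC g a *: b j) (b i).
pose X z : 'M_N := \matrix_(i, j) phi (ncX F z *: b j) (b i).
have lb c h : phi (lincomb b c) h = \sum_i c 0 i * phi (b i) h.
  by rewrite (form_lincomb phiP).
have wE (a : A) f : degree_le n f ->
    (forall f, degree_le n f -> W (a *: f)) ->
    w (a *: f) = (\matrix_(i, j) phi (a *: b j) (b i)) *m w f.
  move=> nf aW; apply/colP=> i; rewrite !mxE.
  have nl : degree_le n (lincomb b (coords phi b f)) by apply: rspan_lincomb.
  rewrite (@form_modI _ _ phiP _ (a *: lincomb b (coords phi b f))); last first.
  - by rewrite -scalerBr; apply/IZ/bs.
  - exact: aW.
  - exact: aW.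
  have -> : a *: lincomb b (coords phi b f) =
      lincomb (fun j => a *: b j) (coords phi b f).
    by rewrite scaler_sumr; apply: eq_bigr => k _; rewrite rscale_ncscale.
  rewrite (form_lincomb phiP) => [|k]; last exact: aW.
  by apply: eq_bigr => k _; rewrite !mxE mulrC.
have adjM (a : A) (f h : vec) : adjmx (a *: f) *m h = adjmx f *m (star a *: h).
  by apply/matrixP=> i j; rewrite !mxE !big_ord1 !mxE starM mulrA.
have rhoC a f : degree_le n f -> w (ncC g a *: f) = rho a *m w f.
  by move=> nf; apply: wE => // f' nf'; apply/WC/Wn.
have XC z f : degree_le n f -> w (ncX F z *: f) = X z *m w f.
  by move=> nf; apply: wE => // f' nf'; apply: WX.
have rho_star a : rho (star a) = (rho a)^T.
  apply/matrixP=> i j; rewrite !mxE (formC phiP); apply/esym.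
  by apply: (form_adj phiP); rewrite ?adjM ?ncstarC //; do ?[exact: Wb|apply: WC].
exists N, rho, X, w; split; first split.
- move=> a a'; apply/matrixP=> i j; rewrite !mxE ncCD scalerDl.
  by rewrite (formD phiP) //; apply: WC.
- move=> a a'; apply/matrixP=> i j; rewrite !mxE ncCM -scalerA.
  have /colP/(_ i) := rhoC a (ncC g a' *: b j) (degree_le_ncC _ (sb j)).
  by rewrite !mxE => ->; apply: eq_bigr => k _; rewrite !mxE.
- move=> r; apply/matrixP=> i j; rewrite !mxE -/(rscale r _).
  by rewrite (formZ phiP); [rewrite bb mulr_natr eq_sym|exact: Wb].
- exact: rho_star.
- move=> z; apply/matrixP=> i j; rewrite !mxE (formC phiP); apply/esym.
  by apply: (form_adj phiP); rewrite ?adjM ?ncstarX //; do ?[exact: Wb|apply: WX].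
(* Compression could destroy this relation; it survives because multiplication by [a] and by
   [star a] preserves degree n. The scalar is carried over to [b i] as [star a], and the result is
   expanded in the basis. *)
- move=> a z ca; apply/matrixP=> i j.
  have -> : (X z *m rho a) i j = phi (ncX F z *: (ncC g a *: b j)) (b i).
    have /colP/(_ i) := XC z (ncC g a *: b j) (degree_le_ncC _ (sb j)).
    by rewrite !mxE => ->; apply: eq_bigr => k _; rewrite !mxE.
  rewrite scalerA -(ncCX _ ca) -scalerA.
  have -> : phi (ncC g a *: (ncX F z *: b j)) (b i) =
            phi (ncX F z *: b j) (ncC g (star a) *: b i).
    by apply: (form_adj phiP); rewrite ?adjM ?ncstarC //; 
      do ?[exact: Wb|apply: WC|apply: WX].
  rewrite (formC phiP) (form_modI phiP _ _ _ (bs _ (degree_le_ncC _ (sb i)))).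
  + rewrite lb mxE; apply: eq_bigr => k _; rewrite (formC phiP (b k)).
    by have /matrixP/(_ k i) := rho_star a; rewrite !mxE => ->.
  + exact: WC.
  + exact: rspan_lincomb.
- move=> f h nf nh; apply/colP=> i; rewrite !mxE (formD phiP) //; exact: Wn.
- exact: rhoC.
- exact: XC.
- move=> f nf; split=> [w0|If].
    have := bs f nf; rewrite (_ : coords phi b f = 0) ?lincomb0 ?subr0 //.
    by rewrite -[LHS]trmxK -/(w f) w0 trmx0.
  by apply/colP=> i; rewrite !mxE (form_I phiP) //; apply: Wn.
Qed.

End Filtration.

End ModI.
End RealScalars.

(** * Evaluation at a matrix tuple and a vector *)

Section EvalVector.
Variables (F : starRingType) (g l n : nat) (X : 'I_g -> 'M[F]_n).
Variable v : 'cV[F]_(\sum_(j < l) n).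
Local Notation A := (ncpoly F g).
Implicit Types u f : 'rV[A]_l.

Definition evalv u : 'cV[F]_n := \sum_j nceval X (u 0 j) *m submxcol v j.

Lemma ncevalmx_mulP m (p : 'M[A]_(m, l)) :
  ncevalmx X p *m v = 0 <-> forall i, evalv (row i p) = 0.
Proof.
have -> : ncevalmx X p *m v = \mxcol_i evalv (row i p).
  rewrite -[in LHS](submxcolK v) mul_mxblock_mxrow; apply: eq_mxcol => i.
  by apply: eq_bigr => j _; rewrite mxE.
split=> [E i|E]; first by rewrite -(mxcolK (fun i => evalv (row i p)) i) E submxcol0.
by apply/mxcolP=> i; rewrite mxcolK submxcol0 E.
Qed.

Lemma nceval0 : nceval X 0 = 0.
Proof. by rewrite -ncC0 ncevalC raddf0. Qed.

Lemma nceval_star a : nceval X (star a) = adjmx (nceval X a).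
Proof.
elim/ncpoly_ind: a => [a|z|p q hp hq|p q hp hq].
- by rewrite ncstarC !ncevalC adjmx_scalar.
- by rewrite ncstarX !ncevalX; case: z => i //=; rewrite adjmxK.
- by rewrite starD !ncevalD adjmxD hp hq.
- by rewrite starM !ncevalM adjmxM hp hq.
Qed.

Lemma evalvD u f : evalv (u + f) = evalv u + evalv f.
Proof.
rewrite -big_split; apply: eq_bigr => j _.
by rewrite mxE ncevalD mulmxDl.
Qed.

Lemma evalvZ a u : evalv (a *: u) = nceval X a *m evalv u.
Proof.
rewrite mulmx_sumr; apply: eq_bigr => j _.
by rewrite mxE ncevalM mulmxA.
Qed.

Lemma evalv0 : evalv 0 = 0.
Proof. by rewrite -(scale0r 0) evalvZ nceval0 mul0mx. Qed.

(** This is v^* M(X) v, written by blocks. *)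
Definition evalq (M : 'M[A]_l) : 'M[F]_1 :=
  \sum_j \sum_k adjmx (submxcol v j) *m nceval X (M j k) *m submxcol v k.

Lemma evalqD M M' : evalq (M + M') = evalq M + evalq M'.
Proof.
rewrite -big_split; apply: eq_bigr => j _; rewrite -big_split.
by apply: eq_bigr => k _; rewrite mxE ncevalD mulmxDr mulmxDl.
Qed.

Lemma evalq0 : evalq 0 = 0.
Proof.
by apply: big1 => j _; apply: big1 => k _; rewrite mxE nceval0 mulmx0 mul0mx.
Qed.

Lemma evalqB M M' : evalq (M - M') = evalq M - evalq M'.
Proof. by apply: (@addIr _ (evalq M')); rewrite -evalqD !subrK. Qed.

Lemma evalq_gram u f : evalq (adjmx u *m f) = adjmx (evalv u) *m evalv f.
Proof.
rewrite /evalv adjmx_sum mulmx_suml; apply: eq_bigr => j _.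
rewrite mulmx_sumr; apply: eq_bigr => k _.
by rewrite mxE big_ord1 !mxE ncevalM nceval_star adjmxM !mulmxA.
Qed.

End EvalVector.

(** * Annihilators are real left modules *)

Section Soundness.
Variables (R : realType) (F : starRingType) (re : {additive F -> R}).
Hypothesis re_ge0 : forall a : F, 0 <= re (star a * a).
Hypothesis re_eq0 : forall a : F, re (star a * a) = 0 -> a = 0.

Lemma adj_sum_eq0 m n (u : 'I_m -> 'cV[F]_n) :
  \sum_i adjmx (u i) *m u i = 0 -> forall i, u i = 0.
Proof.
move=> /matrixP/(_ 0 0); rewrite summxE [RHS]mxE => /(congr1 re).
rewrite raddf0 raddf_sum /= => S0 i.
have ge0 i' : 0 <= re ((adjmx (u i') *m u i') 0 0).
  by rewrite mxE raddf_sum; apply: sumr_ge0 => k _; rewrite !mxE re_ge0.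
have /(_ i isT) := psumr_eq0P (fun i _ => ge0 i) S0.
rewrite mxE raddf_sum /= => Si; apply/colP=> k; rewrite [RHS]mxE; apply: re_eq0.
have ge0k k' : true -> 0 <= re (adjmx (u i) 0 k' * u i k' 0).
  by rewrite !mxE re_ge0.
by have /(_ k isT) := psumr_eq0P ge0k Si; rewrite !mxE.
Qed.

(** The functional v^* M(X) v kills both summands in the definition of realness. On a sum of p_i^*
    p_i it is the sum of the (p_i(X)v)^* p_i(X)v, so every p_i(X)v vanishes. *)
Lemma evalv_ker_real g l n (X : 'I_g -> 'M[F]_n) v :
  real_left_module [set u : 'rV[ncpoly F g]_l | evalv X v u = 0]%classic.
Proof.
set I := mkset _; have ID : left_module I.
  split=> [|u f|a u]; rewrite /I /=; first exact: evalv0.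
    by move=> u0 f0; rewrite evalvD u0 f0 addr0.
  by move=> u0; rewrite evalvZ u0 mulmx0.
split=> // m f [M HM [M' HM' E]] i.
have q0 (G : set 'M[ncpoly F g]_l) : (forall x, G x -> evalq X v x = 0) ->
    forall x, additive_span G x -> evalq X v x = 0.
  move=> G0 x /(_ [set y | evalq X v y = 0]%classic); apply; split=> //=.
  split=> [|a b a0 b0]; first exact: evalq0.
  by rewrite /= evalqB a0 b0 subr0.
have : evalq X v (\sum_i adjmx (f i) *m f i) = 0.
  rewrite -E evalqD (q0 _ _ _ HM) ?(q0 _ _ _ HM') ?addr0 //.
    move=> _ [_ [u u0 <-]] [c _ <-]; rewrite evalq_gram u0.
    by rewrite adjmx0 mul0mx.
  move=> _ [c _] [u u0 <-]; rewrite -[c]adjmxK evalq_gram u0.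
  by rewrite mulmx0.
rewrite (big_morph _ (@evalqD _ _ _ _ X v) (evalq0 X v)).
under eq_bigr do rewrite evalq_gram.
by move/adj_sum_eq0; apply.
Qed.
End Soundness.

Section RealModules.
Variables (F : starRingType) (g l : nat) (I : set 'rV[ncpoly F g]_l).

Lemma hermitian_part_real : real_left_module I ->
  forall m (f : 'I_m -> 'rV[ncpoly F g]_l),
  hermitian_part I (\sum_i adjmx (f i) *m f i) -> forall i, I (f i).
Proof.
move=> [Imod Ireal] m f [U [V [IU IV E]]]; apply: Ireal.
exists U; first exact/(mulset_constP U Imod).
exists (adjmx V); last by rewrite E.
have -> : V = \sum_i map_mx (@ncC F g) (delta_mx i 0 : 'cV_l) *m row i V.
  apply/matrixP=> i j; rewrite summxE (bigD1 i) //= big1 => [|k ki].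
    by rewrite !mxE big_ord1 !mxE !eqxx ncC1 mul1r addr0.
  by rewrite !mxE big_ord1 !mxE eq_sym (negbTE ki) ncC0 mul0r.
move=> G [[G0 GB] subG].
have GD a b : G a -> G b -> G (a + b).
  move=> Ga Gb; rewrite -[b]opprK; apply: (GB _ _ Ga).
  by rewrite -sub0r; apply: (GB).
rewrite adjmx_sum; apply: (@big_ind _ G 0 +%R G0 GD) => i _; apply: subG.
rewrite adjmxM; exists (adjmx (row i V)); first by exists (row i V).
exists (adjmx (map_mx (@ncC F g) (delta_mx i 0))) => //.
exists (adjmx (delta_mx i 0)) => //.
by apply/matrixP=> a b; rewrite !mxE ncstarC.
Qed.
End RealModules.

(** Elements of [ncpoly] are classes of terms, so this is only a syntactic bound for a
    representative; any bound will do, as finitely many entries are involved. *)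
Fixpoint term_degree (F : starRingType) g (t : ncterm F g) : nat :=
  match t with
  | NConst _ => 0
  | NLetter _ => 1
  | NAdd t u => maxn (term_degree t) (term_degree u)
  | NMul t u => term_degree t + term_degree u
  end.

(** [U] is only asked to be additive: its behaviour on scalars is the last clause, where [rho a]
    becomes a scalar matrix. Injectivity keeps the annihilator from growing. *)
Definition dilatable (R : realType) (F : starRingType) (iota : {rmorphism R -> F}) :=
  forall g N (rho : F -> 'M[R]_N) (X : letter g -> 'M[R]_N),
  star_rep iota rho X ->
  exists N' (X' : 'I_g -> 'M[F]_N') (U : 'cV[R]_N -> 'cV[F]_N'),
  [/\ {morph U : u v / u + v}, forall u, U u = 0 -> u = 0,
      forall z u, eval_letter X' z *m U u = U (X z *m u) &
      forall a u, a%:M *m U u = U (rho a *m u)].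

(** * The equivalence over dilatable coefficient rings *)

Section Nullstellensatz.
Local Open Scope quotient_scope.
Variables (R : realType) (F : starRingType) (iota : {rmorphism R -> F}).
Hypothesis iota_central : forall r, central (iota r).
Hypothesis star_iota : forall r, star (iota r) = iota r.
Variables (d : nat) (e : 'I_d -> F).
Hypothesis e_span : forall a, exists c : 'I_d -> R, a = \sum_i iota (c i) * e i.
Hypothesis F_dilatable : dilatable iota.
Variables g l : nat.
Local Notation A := (ncpoly F g).
Local Notation vec := 'rV[A]_l.

Let deg := @degree_le R F iota g l d e.

Lemma degree_le_term n (t : ncterm F g) (f : vec) :
  deg n f -> deg (term_degree t + n) (\pi_(ncpoly F g) t *: f).
Proof.
elim: t n f => [a|z|t IHt u IHu|t IHt u IHu] n f nf /=.
- exact: degree_le_ncC.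
- exact: degree_le_ncX.
- rewrite pi_ncD scalerDl; apply: rspanD.
    by apply: degree_le_mono (IHt _ _ nf); rewrite leq_add2r leq_maxl.
  by apply: degree_le_mono (IHu _ _ nf); rewrite leq_add2r leq_maxr.
- by rewrite pi_ncM -scalerA -addnA; apply/IHt/IHu.
Qed.

(** A single point tests membership in [I] for all rows of bounded degree: [v] stacks the images of
    the unit rows, so u(X)v is the image of u. *)
Lemma faithful_vector n (I : set vec) : real_left_module I ->
  exists N (X : 'I_g -> 'M[F]_N) v, forall u : vec,
    (forall j, term_degree (repr (u 0%R j)) <= n)%N ->
    evalv X v u = 0 <-> I u.
Proof.
move=> Ireal; have [Imod _] := Ireal; have [I0 _ _] := Imod.
have [N [rho [X [w [rhoX wD wC wX w0]]]]] :=
  gns iota_central star_iota Imod (hermitian_part_real Ireal) e_span n.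
have [N' [X' [U [UD U0 UX UC]]]] := F_dilatable rhoX.
(* The degree budget keeps every intermediate vector in degree n, where [w] turns letters into
   matrices. *)
have eval_term t m f : deg m f -> (term_degree t + m <= n)%N ->
    nceval X' (\pi_(ncpoly F g) t) *m U (w f) = U (w (\pi_(ncpoly F g) t *: f)).
  elim: t m f => [a|z|t IHt u IHu|t IHt u IHu] m f mf /= mn.
  - by rewrite -/(ncC g a) ncevalC UC wC //; apply: degree_le_mono mf.
  - rewrite -/(ncX F z) ncevalX UX wX //; apply: degree_le_mono mf.
    by apply: leq_trans mn.
  - have [tn un] : (term_degree t + m <= n)%N /\ (term_degree u + m <= n)%N.
      by split; apply: leq_trans mn; rewrite leq_add2r ?leq_maxl ?leq_maxr.
    rewrite pi_ncD ncevalD mulmxDl (IHt m) // (IHu m) // scalerDl -UD wD //.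
      exact/(degree_le_mono tn)/degree_le_term.
    exact/(degree_le_mono un)/degree_le_term.
  - rewrite pi_ncM ncevalM -mulmxA (IHu m) //; last first.
      by apply: leq_trans mn; rewrite -addnA leq_addl.
    rewrite (IHt (term_degree u + m)%N) ?scalerA ?addnA //.
    exact: degree_le_term.
pose v := \mxcol_(j < l) U (w (delta_mx 0 j : vec)).
exists N', X', v => u un.
have un' j : deg n (u 0 j *: delta_mx 0 j).
  have := degree_le_term (repr (u 0 j)) (@degree_le_delta _ _ iota g l d e e_span j).
  by rewrite reprK addn0; apply: degree_le_mono.
have uE : u = \sum_j u 0 j *: delta_mx 0 j by apply: row_sum_delta.
have nu : deg n u by rewrite uE; apply: rspan_sum.
have UZ : U 0 = 0 by apply: (@addrI _ (U 0)); rewrite -UD !addr0.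
have wZ : w 0 = 0 by apply/(w0 0 (rspan0 _ _)).
suff -> : evalv X' v u = U (w u).
  by have [wI Iw] := w0 u nu; split=> [/U0/wI|/Iw ->].
rewrite /evalv [in RHS]uE.
suff [] : deg n (\sum_j u 0 j *: delta_mx 0 j) /\
  \sum_j nceval X' (u 0 j) *m submxcol v j =
  U (w (\sum_j u 0 j *: delta_mx 0 j)) by [].
elim/big_rec2: _ => [|j x f _ [nf ->]]; 
  first by rewrite wZ UZ; split=> //; apply: rspan0.
split; first exact: (rspanD (un' j) nf).
rewrite (wD _ _ (un' j) nf) UD mxcolK -[u 0 j]reprK (eval_term _ 0%N) //.
  exact: degree_le_delta.
by rewrite addn0.
Qed.

Variable re : {additive F -> R}.
Hypothesis re_ge0 : forall a : F, 0 <= re (star a * a).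
Hypothesis re_eq0 : forall a : F, re (star a * a) = 0 -> a = 0.

Lemma row_module_row k (nu : 'I_k -> nat) (p : forall i, 'M[A]_(nu i, l)) i a :
  row_module p (row a (p i)).
Proof.
exists (dfwith (fun i' => 0 : 'rV[A]_(nu i')) (delta_mx 0 a)) => //=.
rewrite (bigD1 i) //= big1 => [|i' ii']; last first.
  by rewrite dfwith_out ?mul0mx // eq_sym.
by rewrite dfwith_in addr0 rowE.
Qed.

Lemma row_module_evalv k (nu : 'I_k -> nat) (p : forall i, 'M[A]_(nu i, l))
    n (X : 'I_g -> 'M[F]_n) v :
  (forall i, ncevalmx X (p i) *m v = 0) ->
  forall u, row_module p u -> evalv X v u = 0.
Proof.
move=> pv _ [a _ <-]; rewrite (big_morph _ (evalvD X v) (evalv0 X v)).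
apply: big1 => i _; rewrite mulmx_sum_row.
rewrite (big_morph _ (evalvD X v) (evalv0 X v)) big1 // => b _.
by have /ncevalmx_mulP pi0 := pv i; rewrite evalvZ pi0 mulmx0.
Qed.

Theorem module_nullstellensatz k (nu : 'I_k -> nat)
    (p : forall i : 'I_k, 'M[A]_(nu i, l)) m (q : 'M[A]_(m, l)) :
  (forall n (X : 'I_g -> 'M[F]_n) (v : 'cV[F]_(\sum_(j < l) n)),
      (forall i : 'I_k, ncevalmx X (p i) *m v = 0) -> ncevalmx X q *m v = 0)
  <-> Jset p m q.
Proof.
have radP := rrad_real (row_module p).
rewrite /Jset (mulset_constP _ radP.1).
split=> [vanish|radq n X v pv]; last first.
  apply/ncevalmx_mulP => a.
  apply: (radq a [set u | evalv X v u = 0]%classic); split.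
    exact: evalv_ker_real re_ge0 re_eq0 _ _ _ _ _.
  exact: row_module_evalv.
(* The bound covers the p_i as well as q: [faithful_vector] is used in one direction to get p_i(X)v
   = 0 from their rows lying in the radical, and in the other for q. *)
pose D := maxn
  (\max_(i < k) \max_(a < nu i) \max_(j < l) term_degree (repr (p i a j)))
  (\max_(a < m) \max_(j < l) term_degree (repr (q a j))).
have [n [X [v evP]]] := faithful_vector D radP.
have /ncevalmx_mulP qv : ncevalmx X q *m v = 0.
  apply: vanish => i; apply/ncevalmx_mulP => a; apply/evP => [j|].
    rewrite mxE leq_max; apply/orP; left; apply: leq_trans (leq_bigmax i).
    by apply: leq_trans (leq_bigmax a); apply: leq_bigmax.
  by move=> B [_]; apply; apply: row_module_row.
move=> a; apply/evP/qv => j.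
rewrite mxE leq_max; apply/orP; right; apply: leq_trans (leq_bigmax a).
exact: leq_bigmax.
Qed.

End Nullstellensatz.

(** * Dilations over the reals, the complex numbers and the quaternions *)

Section Real.
Variable R : realType.

Lemma real_dilatable : @dilatable R R idfun.
Proof.
move=> g N rho X rhoX; exists N, (fun i => X (inl i)), id; split=> //.
  move=> [i|i] u //=; congr (_ *m _); rewrite (rep_letter rhoX (inl i)).
  by apply/matrixP=> a b; rewrite !mxE.
by move=> a u; rewrite (rep_iota rhoX a).
Qed.
End Real.

Section Complex.
Variable R : realType.

Lemma conjc_Re_ge0 (a : R[i]) : 0 <= complex.Re (conjc a * a).
Proof. by case: a => x y /=; rewrite mulNr opprK addr_ge0 // -expr2 sqr_ge0. Qed.

Lemma conjc_Re_eq0 (a : R[i]) : complex.Re (conjc a * a) = 0 -> a = 0.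
Proof.
case: a => x y /= E; have : x ^+ 2 + y ^+ 2 = 0 by rewrite -E; ring.
by move=> E'; congr Complex; nra.
Qed.

(* u |-> u - i J u, where J := rho i, turns J into the multiplication by i. *)
Lemma complex_dilatable : @dilatable R R[i] (real_complex R).
Proof.
move=> g N rho X rhoX; pose J := rho 'i%C.
pose i : R[i] := 'i%C.
pose toC m n := @map_mx R R[i] (real_complex R) m n.
have rhoE x y : rho (x +i* y)%C = x%:M + y *: J.
  have -> : (x +i* y = real_complex R x + real_complex R y * 'i)%C by simpc.
  by rewrite (repD rhoX) (repM rhoX) !(rep_iota rhoX) mul_scalar_mx.
have JJ : J *m J = (-1)%:M.
  rewrite -(repM rhoX) -(rep_iota rhoX); congr rho.
  by simpc.
(* The imaginary unit is central in C; without this commutation [u - i J u] would not intertwine the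
   letters. *)
have JX z : J *m X z = X z *m J by apply: (rep_central rhoX) => b; apply: mulrC.
exists N, (fun i => toC _ _ (X (inl i))),
  (fun u => toC _ _ u - i *: toC _ _ (J *m u)).
split.
- move=> u v; rewrite mulmxDr /toC !map_mxD scalerDr opprD; exact: addrACA.
- move=> u /matrixP u0; apply/matrixP=> a b; have := u0 a b.
  move: (J *m u) => v; rewrite !mxE => /(congr1 (@complex.Re R)) /=.
  by rewrite !(mulr0, mul0r, subr0).
- move=> z u.
  have -> : eval_letter (fun i => toC _ _ (X (inl i))) z = toC _ _ (X z).
    case: z => z //=; rewrite (rep_letter rhoX (inl z)).
    by apply/matrixP=> a b; rewrite !mxE; apply: conjc_real.
  rewrite mulmxBr -scalemxAr /toC -!map_mxM /= mulmxA -JX mulmxA.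
  by [].
- move=> [x y] u; rewrite rhoE mul_scalar_mx.
  rewrite !mulmxDl mul_scalar_mx -scalemxAl mulmxDr -!scalemxAr mulmxA JJ.
  rewrite mul_scalar_mx scaleN1r.
  apply/matrixP=> a b; move: (J *m u) => v; rewrite !mxE.
  by apply/eqP; rewrite eq_complex /=; apply/andP; split; apply/eqP; ring.
Qed.

End Complex.

Section Quat.
Variable R : realType.
Local Notation H := (quat R).

Definition real_quat (r : R) : H := Quat r 0 0 0.

Let real_quat0 : real_quat 0 = 0. Proof. by []. Qed.
Let real_quat1 : real_quat 1 = 1. Proof. by []. Qed.
Let real_quatD : {morph real_quat : a b / a + b}.
Proof. by move=> a b; congr Quat => /=; ring. Qed.
Let real_quatM : {morph real_quat : a b / a * b}.
Proof. by move=> a b; congr Quat => /=; ring. Qed.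
HB.instance Definition _ :=
  GRing.isNmodMorphism.Build R H real_quat (real_quat0, real_quatD).
HB.instance Definition _ :=
  GRing.isMonoidMorphism.Build R H real_quat (real_quat1, real_quatM).

Let qre_additive : nmod_morphism (@qre R : H -> R).
Proof. by []. Qed.
HB.instance Definition _ := GRing.isNmodMorphism.Build H R (@qre R) qre_additive.

Lemma real_quat_central r : central (real_quat r).
Proof. exact/central_quatP. Qed.

Lemma star_real_quat r : star (real_quat r) = real_quat r.
Proof. by congr Quat; rewrite oppr0. Qed.

Lemma qre_starE (a : H) :
  qre (star a * a) = qre a ^+ 2 + qi a ^+ 2 + qj a ^+ 2 + qk a ^+ 2.
Proof. by case: a => x y z t /=; ring. Qed.

Lemma qre_star_ge0 (a : H) : 0 <= qre (star a * a).
Proof. by rewrite qre_starE !addr_ge0 // sqr_ge0. Qed.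

Lemma qre_star_eq0 (a : H) : qre (star a * a) = 0 -> a = 0.
Proof. by rewrite qre_starE; case: a => x y z t /= E; congr Quat; nra. Qed.

(** Writing k as i j reduces an intertwining property to the reals, i and j. *)
Lemma real_quatE (x y z t : R) : Quat x y z t = real_quat x
  + real_quat y * Quat 0 1 0 0 + real_quat z * Quat 0 0 1 0
  + real_quat t * (Quat 0 1 0 0 * Quat 0 0 1 0).
Proof. by congr Quat => /=; ring. Qed.

(** These are the sixteen signed products in the square of [V] below: [T 1 1], [T qi qi], [T qj qj],
    [T qk qk] multiply as the Klein four-group, and the cross terms cancel. *)
Lemma involutions_sum4 (M : zmodType) (u a b c : M) :
  u - a - b - c - (a - u - c - - - b) - (b - - - c - u - a) -
  (c - b - - - a - u) = u + u + u + u.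
Proof.
rewrite !opprK !(opprD, opprB, opprK) !addrA.
rewrite [LHS](GRing.add.[ACl
  (1*7*10*13)*(2*9)*(8*14)*(3*5)*(12*15)*(4*6)*(16*11)]) /=.
by rewrite !addNr !addr0.
Qed.

(* V / 2 is a self-adjoint unitary exchanging the scalar matrix of a quaternion q
   with the real matrix rho q, so conjugating the real matrices by it makes the
   quaternions act as scalar matrices. *)
Lemma quat_dilatable : @dilatable R H real_quat.
Proof.
move=> g N rho X rhoX.
pose toH m n := @map_mx R H real_quat m n.
(* [T q p] plays the role of q ⊗ p in H ⊗ H: the two factors commute because [rho p] has real
   entries. *)
pose T q p : 'M[H]_N := q%:M *m toH _ _ (rho p).
have rC m n r (M : 'M[H]_(m, n)) :
    (real_quat r)%:M *m M = M *m (real_quat r)%:M.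
  apply/matrixP=> a b; rewrite mul_scalar_mx !mxE (bigD1 b) //= big1 => [|c cb].
    by rewrite !mxE eqxx mulr1n addr0 real_quat_central.
  by rewrite !mxE (negbTE cb) mulr0.
have scalC m n q (M : 'M[R]_(m, n)) : q%:M *m toH _ _ M = toH _ _ M *m q%:M.
  apply/matrixP=> a b; rewrite mul_scalar_mx !mxE (bigD1 b) //= big1 => [|c cb].
    by rewrite !mxE eqxx mulr1n addr0 (real_quat_central _ q).
  by rewrite !mxE (negbTE cb) mulr0.
have rho1 : rho 1 = 1%:M by rewrite -(rmorph1 real_quat) (rep_iota rhoX).
have rhoN a : rho (- a) = - rho a.
  by apply: (@addIr _ (rho a)); rewrite -(repD rhoX) !addNr
    -(rmorph0 real_quat) (rep_iota rhoX) raddf0.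
have TM q p q' p' : T q p *m T q' p' = T (q * q') (p * p').
  by rewrite /T mulmxA -(mulmxA q%:M) -scalC mulmxA
    -scalar_mxM -mulmxA -map_mxM (repM rhoX).
have TN q p : T (- q) (- p) = T q p.
  by rewrite /T rhoN raddfN /= /toH map_mxN mulmxN mulNmx opprK.
have TNl q p : T (- q) p = - T q p by rewrite /T raddfN /= mulNmx.
have T1 : T 1 1 = 1%:M by rewrite /T rho1 mul1mx /toH map_mx1.
have Tadj q p : adjmx (T q p) = T (star q) (star p).
  rewrite /T adjmxM adjmx_scalar (rep_star rhoX) scalC; congr (_ *m _).
  by apply/matrixP=> i j; rewrite !mxE star_real_quat.
have TL q : T q 1 = q%:M by rewrite /T rho1 /toH map_mx1 mulmx1.
have TR q : T 1 q = toH _ _ (rho q) by rewrite /T mul1mx.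
have TDl q q' p : T (q + q') p = T q p + T q' p.
  by rewrite /T raddfD mulmxDl.
have TDr q p p' : T q (p + p') = T q p + T q p'.
  by rewrite /T (repD rhoX) /toH map_mxD mulmxDr.
clearbody T.
pose qi : H := Quat 0 1 0 0; pose qj : H := Quat 0 0 1 0.
pose qk : H := Quat 0 0 0 1.
pose V : 'M[H]_N := T 1 1 - T qi qi - T qj qj - T qk qk.
have qii : qi * qi = -1 by congr Quat => /=; ring.
have qjj : qj * qj = -1 by congr Quat => /=; ring.
have qkk : qk * qk = -1 by congr Quat => /=; ring.
have qij : qi * qj = qk by congr Quat => /=; ring.
have qji : qj * qi = - qk by congr Quat => /=; ring.
have qjk : qj * qk = qi by congr Quat => /=; ring.
have qkj : qk * qj = - qi by congr Quat => /=; ring.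
have qki : qk * qi = qj by congr Quat => /=; ring.
have qik : qi * qk = - qj by congr Quat => /=; ring.
have qE := (qii, qjj, qkk, qij, qji, qjk, qkj, qki, qik).
have TNr q p : T q (- p) = - T q p by rewrite -TNl -[q in T q (- p)]opprK TN.
have VV : V *m V = (real_quat 4)%:M.
  rewrite /V !(mulmxBl, mulmxBr) !TM !qE !mulr1 !mul1r !(TN, TNl, TNr).
  rewrite T1 involutions_sum4.
  by rewrite -!raddfD; congr (_%:M); congr Quat => /=; ring.
have Vadj : adjmx V = V.
  rewrite /V !adjmxB !Tadj star1.
  have -> : star qi = - qi by congr Quat; rewrite /= oppr0.
  have -> : star qj = - qj by congr Quat; rewrite /= oppr0.
  have -> : star qk = - qk by congr Quat; rewrite /= oppr0.
  by rewrite !TN.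
have TVr r : T (real_quat r) 1 *m V = V *m T 1 (real_quat r).
  by rewrite TL TR (rep_iota rhoX) /toH map_scalar_mx rC.
have TVM q q' : T q 1 *m V = V *m T 1 q -> T q' 1 *m V = V *m T 1 q' ->
    T (q * q') 1 *m V = V *m T 1 (q * q').
  move=> Eq Eq'; have -> : T (q * q') 1 = T q 1 *m T q' 1 by rewrite TM mulr1.
  by rewrite -mulmxA Eq' mulmxA Eq -mulmxA TM mulr1.
have TVi : T qi 1 *m V = V *m T 1 qi.
  rewrite /V !(mulmxBl, mulmxBr) !TM !mulr1 !mul1r !qE !(TNl, TNr) !opprK.
  by rewrite [T qi 1 + _]addrC addrAC.
have TVj : T qj 1 *m V = V *m T 1 qj.
  rewrite /V !(mulmxBl, mulmxBr) !TM !mulr1 !mul1r !qE !(TNl, TNr) !opprK.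
  by rewrite -addrA addrC addrA.
have TVD q q' : T q 1 *m V = V *m T 1 q -> T q' 1 *m V = V *m T 1 q' ->
    T (q + q') 1 *m V = V *m T 1 (q + q').
  by move=> Eq Eq'; rewrite TDl mulmxDl Eq Eq' -mulmxDr -TDr.
have TV q : T q 1 *m V = V *m T 1 q.
  case: q => x y z t; rewrite real_quatE.
  exact: TVD (TVD _ _ (TVD _ _ (TVr x) (TVM _ _ (TVr y) TVi))
    (TVM _ _ (TVr z) TVj)) (TVM _ _ (TVr t) (TVM _ _ TVi TVj)).
have VT q : q%:M *m V = V *m toH _ _ (rho q) by rewrite -TL TV TR.
have VVK m (M : 'M_(N, m)) : V *m (V *m ((real_quat 4^-1)%:M *m M)) = M.
  by rewrite !mulmxA VV -scalar_mxM -rmorphM /= mulfV ?pnatr_eq0 // mul1mx.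
(* The factor 1/4 compensates [V *m V], which is 4 times the identity. *)
exists N, (fun i => (real_quat 4^-1)%:M *m (V *m toH _ _ (X (inl i)) *m V)).
exists (fun u => V *m toH _ _ u); split.
- by move=> u v; rewrite /toH map_mxD mulmxDr.
- move=> u Vu; have : toH _ _ u = 0.
    by rewrite -[LHS]VVK rC (mulmxA V (toH _ _ u)) Vu mul0mx mulmx0.
  by move=> /matrixP u0; apply/matrixP=> a b; have := u0 a b; rewrite !mxE => -[].
- move=> z u.
  have -> : eval_letter (fun i =>
      (real_quat 4^-1)%:M *m (V *m toH _ _ (X (inl i)) *m V)) z =
    (real_quat 4^-1)%:M *m (V *m toH _ _ (X z) *m V).
    case: z => z //=; rewrite !adjmxM adjmx_scalar star_real_quat Vadj -rC.
    have -> : adjmx (toH _ _ (X (inl z))) = toH _ _ (X (inr z)).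
      rewrite (rep_letter rhoX (inl z)).
      by apply/matrixP=> a b; rewrite !mxE star_real_quat.
    by rewrite mulmxA.
  rewrite rC -!mulmxA (mulmxA (real_quat 4^-1)%:M V) (rC _ _ _ V) -mulmxA VVK.
  by rewrite /toH map_mxM.
- by move=> a u; rewrite mulmxA VT -mulmxA /toH map_mxM.
Qed.

End Quat.

Theorem corollary6p3 (R : realType) (F : starRingType)
    (hF : [\/ F = (R : starRingType), F = (R[i] : starRingType)
            | F = (quat R : starRingType)])
    (g l k : nat) (nu : 'I_k -> nat)
    (p : forall i : 'I_k, 'M[ncpoly F g]_(nu i, l))
    (m : nat) (q : 'M[ncpoly F g]_(m, l)) :
  (forall (n : nat) (X : 'I_g -> 'M[F]_n) (v : 'cV[F]_(\sum_(j < l) n)),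
      (forall i : 'I_k, ncevalmx X (p i) *m v = 0) -> ncevalmx X q *m v = 0)
  <-> Jset p m q.
Proof.
case: hF p q => -> p q.
- apply: (@module_nullstellensatz R R idfun _ _ 1 (fun=> 1) _ _ g l idfun).
  + by move=> r s; apply: GRing.mulrC.
  + by [].
  + by move=> a; exists (fun=> a); rewrite big_ord1 GRing.mulr1.
  + exact: real_dilatable.
  + by move=> a; rewrite -GRing.expr2 Num.Theory.sqr_ge0.
  + by move=> a /eqP; rewrite GRing.mulf_eq0 orbb => /eqP.
- apply: (@module_nullstellensatz R R[i] (real_complex R) _ _ 2
    (fun i : 'I_2 => if i == 0 then 1 else 'i%C) _ _ g l
    (@complex.Re R : {additive Rcomplex R -> R})).
  + by move=> r s; apply: GRing.mulrC.
  + exact: conjc_real.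
  + move=> [x y]; exists (fun i : 'I_2 => if i == 0 then x else y).
    by rewrite !big_ord_recl big_ord0 /=; simpc.
  + exact: complex_dilatable.
  + exact: conjc_Re_ge0.
  + exact: conjc_Re_eq0.
- apply: (@module_nullstellensatz R (quat R) (@real_quat R) _ _ 4
    (fun i : 'I_4 => nth 0 [:: 1; Quat 0 1 0 0; Quat 0 0 1 0; Quat 0 0 0 1] i)
    _ _ g l (@qre R)).
  + exact: real_quat_central.
  + exact: star_real_quat.
  + move=> [x y z t]; exists (fun i : 'I_4 => nth 0 [:: x; y; z; t] i).
    rewrite !big_ord_recl big_ord0 /=.
    by congr Quat => /=; ring.
  + exact: quat_dilatable.
  + exact: qre_star_ge0.
  + exact: qre_star_eq0.
Qed.
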